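(* For every $b>0$, $$ \lim_{\delta\to 0}\limsup_{t\to\infty}\frac 1t \log\, \mathbb P\bigg\{\sup_{x_1,x_2\in\mathbb{R}^3\colon |x_1-x_2|\leq \delta} \, \big| \Lambda_t(x_1)-\Lambda_t(x_2)\big| \geq b\bigg\}=-\infty. $$
   Context: $\mathbb P$ is the Wiener measure of a three-dimensional Brownian motion $W=(W_t)_{t\ge0}$ started at the origin. For $t>0$ and $x\in\mathbb R^3$, $\Lambda_t(x)=\frac1t\int_0^t\frac{\mathrm ds}{|W_s-x|}$ (the Coulomb potential of the normalized occupation measure $L_t=\frac1t\int_0^t\delta_{W_s}\mathrm ds$). *)

(* Defs.v *)
From HB Require Import structures.
From mathcomp Require Import all_boot all_order all_algebra.
From mathcomp Require Import all_classical all_reals all_analysis.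
Set Implicit Arguments. Unset Strict Implicit. Unset Printing Implicit Defensive.
Import Order.TTheory GRing.Theory Num.Theory.
Import numFieldNormedType.Exports.
Local Open Scope classical_set_scope.
Local Open Scope ring_scope.

(* Euclidean norm on R^3 (the library's norm on 'rV is the max norm). *)
Definition enorm3 {R : realType} (v : 'rV[R]_3) : R :=
  Num.sqrt (\sum_(i < 3) v ord0 i ^+ 2).

(* W is a standard three-dimensional Brownian motion started at the origin
   under P: W_0 = 0, continuous paths on [0,oo), measurable coordinates, and
   for all times 0 = t_0 < t_1 < ... < t_n the coordinates of the increments
   W_{t_(i+1)} - W_{t_i} are independent centred Gaussians of variance
   t_(i+1) - t_i (finite-dimensional distributions of Wiener measure). *)
Definition is_BM3 {R : realType} {d : measure_display} {T : measurableType d}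
  (P : probability T R) (W : R -> T -> 'rV[R]_3) : Prop :=
  [/\ forall w, W 0 w = 0,
      forall w, {within [set t : R | 0 <= t], continuous (fun t => W t w)},
      forall t (k : 'I_3), measurable_fun setT (fun w => W t w ord0 k) &
      forall (n : nat) (tt : nat -> R) (A : nat -> 'I_3 -> set R),
        tt 0%N = 0 ->
        (forall i, (i < n)%N -> tt i < tt i.+1) ->
        (forall i k, measurable (A i k)) ->
        P [set w | forall i (k : 'I_3), (i < n)%N ->
                     A i k ((W (tt i.+1) w - W (tt i) w) ord0 k)] =
        (\prod_(i < n) \prod_(k < 3)
            normal_prob 0 (Num.sqrt (tt i.+1 - tt i)) (A i k))%E].

Definition Lambda {R : realType} {T : Type} (W : R -> T -> 'rV[R]_3)
  (t : R) (w : T) (x : 'rV[R]_3) : \bar R :=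
  ((t^-1)%:E * \int[lebesgue_measure]_(s in [set s : R | (0 <= s <= t)%R])
      (if W s w == x then +oo else ((enorm3 (W s w - x))^-1)%:E))%E.

Definition modulus_event {R : realType} {T : Type} (W : R -> T -> 'rV[R]_3)
  (t delta b : R) : set T :=
  [set w | (b%:E <= ereal_sup
      [set `|Lambda W t w p.1 - Lambda W t w p.2|%E |
         p in [set p : 'rV[R]_3 * 'rV[R]_3 | (enorm3 (p.1 - p.2) <= delta)%R]])%E].

Definition log_rate {R : realType} {d : measure_display} {T : measurableType d}
  (P : probability T R) (t : R) (E : set T) : \bar R :=
  if P E == 0%E then -oo%E else (t^-1 * ln (fine (P E)))%:E.

(* Main.v *)
(** The singular part of the Coulomb kernel is dominated by the layers
    [4^(k+1) * 1{|y| <= 4^-k}], [k >= k0], while the part truncated at distance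
    [4^-k0] is Lipschitz, so that it cannot oscillate by [b / 4] once [delta] is
    small.  It remains to bound, uniformly in [x], the time that [W] spends before
    [t] in the ball of radius [rho = 4^-k] around [x].  Reading [W] along the grid
    of mesh [rho^2] started at [u], and expanding [(1 + a)^N] over the subsets of
    the [N] visits to the ball, one bounds it by a sum over chains of grid times
    with consecutive increments at most [2 * rho]; this sum does not depend on
    [x].  The Gaussian density gives a factor [O(l^(-3/2))] for a gap of [l] steps,
    which is summable in dimension three, so the expectation of the sum is linear
    in the number of grid points.  Averaging over [u] (by convexity of [exp]) and
    Markov's inequality show that the occupation time exceeds
    [C * t * 2^k * rho^2] with probability at most [O(t * 16^k) * exp (- c t 2^k)].
    Summing over [k >= k0] gives the rate [- c * 2^k0 / 2].

    [P] is only meaningful on measurable sets, so the event must be measurable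
    although it is a supremum over an uncountable set of a function which may take
    the value [+oo].  The potentials are averaged over small squares: two
    dimensions suffice to make the averaged kernel bounded, continuous and
    dominated by a multiple of the kernel itself, and the oscillation is then the
    supremum over rational points of the oscillations of the averaged
    potentials. *)
Require Import Defs.
From HB Require Import structures.
From mathcomp Require Import all_boot all_order all_algebra.
From mathcomp Require Import all_classical all_reals all_analysis.
From mathcomp Require Import measurable_realfun ring lra.
Import Order.TTheory GRing.Theory Num.Theory.
Import numFieldNormedType.Exports.
Local Open Scope classical_set_scope.
Local Open Scope ring_scope.
Set Implicit Arguments.
Unset Strict Implicit.
Unset Printing Implicit Defensive.

(** * Euclidean norm and Coulomb kernel *)
Section enorm3_theory.
Context {R : realType}.
Implicit Types u v : 'rV[R]_3.

Lemma enorm3E v : enorm3 v =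
  Num.sqrt (v ord0 0 ^+ 2 + v ord0 1 ^+ 2 + v ord0 2%:R ^+ 2).
Proof.
rewrite /enorm3 !big_ord_recl big_ord0 addr0 addrA.
by do ?[congr (Num.sqrt _)]; congr (_ + _ + _);
  congr (v _ _ ^+ 2); apply/val_inj.
Qed.

Lemma enorm3_ge0 v : 0 <= enorm3 v.
Proof. exact: sqrtr_ge0. Qed.

Lemma enorm3_sqr v :
  enorm3 v ^+ 2 = v ord0 0 ^+ 2 + v ord0 1 ^+ 2 + v ord0 2%:R ^+ 2.
Proof. by rewrite enorm3E sqr_sqrtr// !addr_ge0// sqr_ge0. Qed.

Lemma coord_le_enorm3 v k : `|v ord0 k| <= enorm3 v.
Proof.
rewrite -sqrtr_sqr /enorm3 ler_sqrt; last by apply: sumr_ge0 => i _; exact: sqr_ge0.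
by rewrite (bigD1 k)//= lerDl; apply: sumr_ge0 => i _; exact: sqr_ge0.
Qed.

Lemma enorm3_eq0 v : (enorm3 v == 0) = (v == 0).
Proof.
apply/eqP/eqP => [v0|->]; last first.
  by apply/eqP; rewrite -sqrf_eq0 enorm3_sqr !mxE expr0n /= !addr0.
apply/rowP => k; rewrite mxE; apply/eqP; rewrite -normr_le0.
by rewrite -v0 coord_le_enorm3.
Qed.

Lemma enorm3_0 : enorm3 (0 : 'rV[R]_3) = 0.
Proof. by apply/eqP; rewrite enorm3_eq0. Qed.

Lemma enorm3Z (a : R) v : enorm3 (a *: v) = `|a| * enorm3 v.
Proof.
apply/eqP; rewrite -(@eqrXn2 _ 2)// ?mulr_ge0 ?enorm3_ge0//.
by rewrite exprMn !enorm3_sqr !mxE real_normK ?num_real//; apply/eqP; ring.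
Qed.

Lemma enorm3N v : enorm3 (- v) = enorm3 v.
Proof. by rewrite -scaleN1r enorm3Z normrN normr1 mul1r. Qed.

Lemma enorm3_distC u v : enorm3 (u - v) = enorm3 (v - u).
Proof. by rewrite -enorm3N opprB. Qed.

Lemma ler_enorm3D u v : enorm3 (u + v) <= enorm3 u + enorm3 v.
Proof.
rewrite -(@ler_pXn2r _ 2)// ?nnegrE ?addr_ge0 ?enorm3_ge0//.
rewrite sqrrD !enorm3_sqr !mxE.
set a := u ord0 0; set b := u ord0 1; set c := u ord0 2%:R.
set x := v ord0 0; set y := v ord0 1; set z := v ord0 2%:R.
have CS : a * x + b * y + c * z <= enorm3 u * enorm3 v.
  apply: (le_trans (ler_norm _)).
  rewrite -(@ler_pXn2r _ 2)// ?nnegrE ?mulr_ge0 ?enorm3_ge0//.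
  rewrite exprMn !enorm3_sqr real_normK ?num_real// -/a -/b -/c -/x -/y -/z.
  rewrite -subr_ge0.
  have -> : (a ^+ 2 + b ^+ 2 + c ^+ 2) * (x ^+ 2 + y ^+ 2 + z ^+ 2) -
    (a * x + b * y + c * z) ^+ 2 =
    (a * y - b * x) ^+ 2 + (a * z - c * x) ^+ 2 + (b * z - c * y) ^+ 2 by ring.
  by rewrite !addr_ge0// sqr_ge0.
lra.
Qed.

Lemma ler_enorm3_dist u v : `|enorm3 u - enorm3 v| <= enorm3 (u - v).
Proof.
have h (a b : 'rV[R]_3) : enorm3 a <= enorm3 b + enorm3 (a - b).
  by have := ler_enorm3D b (a - b); rewrite (addrC b) subrK.
by rewrite ler_norml; have := h u v; have := h v u; rewrite (enorm3_distC v u); lra.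
Qed.

Lemma enorm3_le_coord v (e : R) : (forall k, `|v ord0 k| <= e) -> enorm3 v <= 2 * e.
Proof.
move=> ve; have e0 : 0 <= e := le_trans (normr_ge0 _) (ve 0).
have h k : v ord0 k ^+ 2 <= e ^+ 2.
  by rewrite -real_normK ?num_real// ler_pXn2r// ?nnegrE.
rewrite -(@ler_pXn2r _ 2)// ?nnegrE ?mulr_ge0 ?enorm3_ge0// enorm3_sqr.
by have := h 0; have := h 1; have := h 2%:R; nra.
Qed.

Lemma measurable_enorm3 {d} {X : measurableType d} (D : set X) (f : X -> 'rV[R]_3) :
  (forall k, measurable_fun D (fun x => f x ord0 k)) ->
  measurable_fun D (fun x => enorm3 (f x)).
Proof.
move=> mf; have mD k := mf k.
apply: (@measurableT_comp _ _ _ _ _ _ (@Num.sqrt R)).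
  by apply: continuous_measurable_fun; exact: sqrt_continuous.
by apply: measurable_sum => k; exact: measurable_funX.
Qed.

End enorm3_theory.

(* The Coulomb kernel as a function of the distance; [+oo] at the pole. *)
Definition coulomb {R : realType} (r : R) : \bar R :=
  if r == 0 then +oo%E else r^-1%:E.

Section coulomb_theory.
Context {R : realType}.
Implicit Types r : R.

Lemma coulomb_ge0 r : 0 <= r -> (0 <= coulomb r)%E.
Proof. by move=> r0; rewrite /coulomb; case: ifP => // _; rewrite lee_fin invr_ge0. Qed.

Lemma coulomb_enorm3_ge0 (v : 'rV[R]_3) : (0 <= coulomb (enorm3 v))%E.
Proof. exact/coulomb_ge0/enorm3_ge0. Qed.

Lemma measurable_coulomb {d} {X : measurableType d} (f : X -> R) :
  (forall x, 0 <= f x) -> measurable_fun setT f ->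
  measurable_fun setT ((fun x => coulomb (f x)) : X -> \bar R).
Proof.
move=> f0 mf.
have -> : (fun x => coulomb (f x)) =
    (fun x => if f x == 0 then +oo%E else (f x `^ (-1))%:E).
  by apply/funext => x; rewrite /coulomb powR_inv1.
apply: measurable_fun_ifT => //; first exact: measurable_fun_eqr.
apply/measurable_EFinP.
exact: (@measurableT_comp _ _ _ _ _ _ (@powR R ^~ (-1))).
Qed.

Lemma measurable_maxV {d} {X : measurableType d} (f : X -> R) (e : R) :
  0 < e -> measurable_fun setT f ->
  measurable_fun setT (fun x => (Num.max (f x) e)^-1).
Proof.
move=> e0 mf.
have -> : (fun x => (Num.max (f x) e)^-1) = (fun x => Num.max (f x) e `^ (-1)).
  by apply/funext => x; rewrite powR_inv1// le_max (ltW e0) orbT.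
apply: (@measurableT_comp _ _ _ _ _ _ (@powR R ^~ (-1))); first exact: measurable_powR.
exact: measurable_maxr.
Qed.

Lemma le_coulomb r r' : 0 <= r -> r <= r' -> (coulomb r' <= coulomb r)%E.
Proof.
move=> r0 rr'; rewrite /coulomb; case: eqVneq => [r'0|r'n0].
  by have -> : r = 0; [apply/eqP; rewrite eq_le r0 andbT -r'0|rewrite eqxx].
have [|rn0] := eqVneq r 0; first by rewrite leey.
have r_gt0 : 0 < r by rewrite lt_neqAle eq_sym rn0.
by rewrite lee_fin lef_pV2// posrE (lt_le_trans r_gt0).
Qed.

Definition scale4 k : R := 4^-1 ^+ k.

Lemma scale4_gt0 k : 0 < scale4 k.
Proof. by rewrite exprn_gt0. Qed.

Lemma scale4_ge0 k : 0 <= scale4 k.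
Proof. exact/ltW/scale4_gt0. Qed.

Lemma scale4V k : (scale4 k)^-1 = 4 ^+ k.
Proof. by rewrite /scale4 exprVn invrK. Qed.

Lemma scale4_cvg0 : scale4 k @[k --> \oo] --> (0 : R).
Proof. by apply: cvg_expr; rewrite ger0_norm// invf_lt1// ltr1n. Qed.

Lemma scale4_lt e : 0 < e -> exists k, scale4 k < e.
Proof.
move=> e0; have /cvgrPdist_lt/(_ _ e0)[N _ /(_ N (leqnn _))] := scale4_cvg0.
by rewrite sub0r normrN gtr0_norm ?scale4_gt0// => ?; exists N.
Qed.

Lemma nneseries_ge_term (f : nat -> \bar R) k :
  (forall i, 0 <= f i)%E -> (f k <= \sum_(i <oo) f i)%E.
Proof.
move=> f0; apply: (le_trans _ (nneseries_lim_ge k.+1 _)); last by move=> *; exact: f0.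
by rewrite big_mkord big_ord_recr/= leeDr// sume_ge0.
Qed.

Lemma nneseries_le (f : nat -> \bar R) (B : \bar R) :
  (forall i, 0 <= f i)%E -> (forall n, \sum_(i < n) f i <= B)%E ->
  (\sum_(i <oo) f i <= B)%E.
Proof.
move=> f0 fB; apply: lime_le.
  by apply: is_cvg_nneseries => *; exact: f0.
by apply: nearW => n; rewrite big_mkord; exact: fB.
Qed.

Definition layer k r : R := 4 ^+ k.+1 * (r <= scale4 k)%R%:R.

Lemma measurable_le_set {d} {X : measurableType d} (N : X -> R) c :
  measurable_fun setT N -> measurable [set z | N z <= c].
Proof.
move=> mN; rewrite -[X in measurable X]setTI.
exact: (measurable_fun_le measurableT mN (@measurable_cst _ _ _ _ _ c)).
Qed.

Lemma le_indic {X : Type} (N : X -> R) c z :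
  (N z <= c)%R%:R = \1_[set z | N z <= c] z :> R.
Proof.
rewrite indicE; suff -> : (z \in [set z | N z <= c]) = (N z <= c) by [].
by apply/idP/idP => [/set_mem|/mem_set].
Qed.

Lemma measurable_le_indic {d} {X : measurableType d} (N : X -> R) c :
  measurable_fun setT N -> measurable_fun setT (fun z => ((N z <= c)%R%:R : R)%:E).
Proof.
move=> mN; apply/measurable_EFinP; under eq_fun do rewrite le_indic.
exact/measurable_indic/measurable_le_set.
Qed.

Lemma measurable_layer {d} {X : measurableType d} (N : X -> R) k :
  measurable_fun setT N -> measurable_fun setT (fun z => (layer k (N z))%:E).
Proof.
move=> mN; under eq_fun do rewrite EFinM.
exact/measurable_funeM/measurable_le_indic.
Qed.

Lemma layer_ge0 k r : 0 <= layer k r.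
Proof. by rewrite mulr_ge0. Qed.

Lemma coulomb_le_layers k0 r : 0 <= r ->
  (coulomb r <= (Num.max r (scale4 k0))^-1%:E +
                \sum_(k <oo) (layer (k0 + k) r)%:E)%E.
Proof.
move=> r0; have f0 i : (0 <= (layer (k0 + i) r)%:E)%E by rewrite lee_fin layer_ge0.
have m0 : (0 <= (Num.max r (scale4 k0))^-1%:E)%E.
  by rewrite lee_fin invr_ge0 le_max r0.
have [r00|rn0] := eqVneq r 0.
  suff -> : (\sum_(k <oo) (layer (k0 + k) r)%:E = +oo)%E by rewrite addey ?leey.
  apply/eqyP => A A0.
  have [k hk] : exists k, A <= 4 ^+ k.
    have [k hk] := @scale4_lt A^-1 ltac:(by rewrite invr_gt0); exists k.
    by rewrite -scale4V -[A]invrK lef_pV2 ?posrE ?scale4_gt0 ?invr_gt0// ltW.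
  apply: (le_trans _ (@nneseries_ge_term _ k f0)).
  rewrite lee_fin /layer r00 scale4_ge0 mulr1 (le_trans hk)// ler_weXn2l ?ler1n//.
  by rewrite ltnW// ltnS leq_addl.
rewrite /coulomb (negbTE rn0).
have rp : 0 < r by rewrite lt_neqAle eq_sym rn0.
have [rk|rk] := ltP (scale4 k0) r.
  by apply: leeDl; exact: nneseries_ge0.
have ex : exists k, scale4 (k0 + k) < r.
  have [k hk] := scale4_lt rp; exists k; apply: le_lt_trans hk.
  by rewrite /scale4 ler_wiXn2l// ?invf_le1 ?ler1n// leq_addl.
have /= := ex_minnP ex; case=> -[|k]; first by rewrite addn0 ltNge rk.
move=> hk hmin.
have rk' : r <= scale4 (k0 + k).
  by rewrite leNgt; apply/negP => /hmin; rewrite ltnn.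
apply: (@le_trans _ _ (layer (k0 + k) r)%:E); last first.
  apply: (le_trans (@nneseries_ge_term _ k f0)); apply: leeDr.
  by rewrite lee_fin invr_ge0 scale4_ge0.
rewrite lee_fin /layer rk' mulr1 -addnS -scale4V lef_pV2 ?posrE ?scale4_gt0//.
exact: ltW.
Qed.

Lemma maxV_le_coulomb (e r : R) : 0 <= r -> 0 < e ->
  ((Num.max r e)^-1%:E <= coulomb r)%E.
Proof.
move=> r0 e0; rewrite /coulomb; case: eqVneq => [_|rn0]; first exact: leey.
have rp : 0 < r by rewrite lt_neqAle eq_sym rn0.
by rewrite lee_fin lef_pV2 ?posrE ?lt_max ?rp// le_max lexx.
Qed.

Lemma maxV_lip (e r r' : R) : 0 < e ->
  (Num.max r e)^-1 <= (Num.max r' e)^-1 + `|r - r'| / e ^+ 2.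
Proof.
move=> e0; set a := Num.max r e; set a' := Num.max r' e.
have ea : e <= a by rewrite le_max lexx orbT.
have ea' : e <= a' by rewrite le_max lexx orbT.
have ap : 0 < a := lt_le_trans e0 ea.
have ap' : 0 < a' := lt_le_trans e0 ea'.
have aa : a' - a <= `|r - r'|.
  rewrite /a /a' lerBlDr ge_max; apply/andP; split.
    have := ler_norm (r' - r); rewrite distrC => h.
    have : r <= Num.max r e by rewrite le_max lexx.
    lra.
  by rewrite (le_trans ea)// lerDr.
rewrite -lerBlDl.
have -> : a^-1 - a'^-1 = (a' - a) / (a * a') by field; rewrite !gt_eqF.
apply: (@le_trans _ _ (`|r - r'| / (a * a'))).
  by rewrite ler_wpM2r// invr_ge0 mulr_ge0// ltW.
rewrite ler_wpM2l// lef_pV2 ?posrE ?mulr_gt0 ?exprn_gt0//.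
by rewrite expr2 ler_pM// ltW.
Qed.

Lemma geo4_sum n : \sum_(k < n) scale4 k <= 2.
Proof.
suff : \sum_(k < n) scale4 k <= 2 * (1 - scale4 n) by have := scale4_gt0 n; lra.
elim: n => [|n ih]; first by rewrite big_ord0 /scale4 expr0 subrr mulr0.
rewrite big_ord_recr/= {3}/scale4 exprS -/(scale4 n); have := scale4_gt0 n; lra.
Qed.

End coulomb_theory.

Section probability_integral.
Local Open Scope ereal_scope.
Context {d} {X : measurableType d} {R : realType} (mu : probability X R).

Lemma probability_integral_le (f : X -> \bar R) c :
  measurable_fun setT f -> (forall x, 0 <= f x) -> (forall x, f x <= c) ->
  \int[mu]_x f x <= c.
Proof.
move=> mf f0 fc; apply: (@le_trans _ _ (\int[mu]_x cst c x)).
  by apply: ge0_le_integral => //.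
by rewrite integral_cst//=; rewrite [X in _ * X](probability_setT mu) mule1.
Qed.

Lemma probability_integral_ge (f : X -> \bar R) c :
  measurable_fun setT f -> 0 <= c -> (forall x, c <= f x) ->
  c <= \int[mu]_x f x.
Proof.
move=> mf c0 fc; apply: (@le_trans _ _ (\int[mu]_x cst c x)).
  by rewrite integral_cst//=; rewrite [X in _ * X](probability_setT mu) mule1.
by apply: ge0_le_integral => //.
Qed.

Lemma probability_integralDc (f : X -> \bar R) c :
  measurable_fun setT f -> (forall x, 0 <= f x) -> 0 <= c ->
  \int[mu]_x (f x + c) = \int[mu]_x f x + c.
Proof.
move=> mf f0 c0; rewrite ge0_integralD//.
by rewrite (integral_cst _ _ c)//=; rewrite [X in _ * X](probability_setT mu) mule1.
Qed.

End probability_integral.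

Section ereal_dist.
Local Open Scope ereal_scope.
Context {R : realType}.
Implicit Types a b c : \bar R.

Lemma lee_dist a b c : a \is a fin_num -> b \is a fin_num ->
  a <= b + c -> b <= a + c -> `|a - b| <= c.
Proof.
case: a => [a| |]//; case: b => [b| |]//; case: c => [c| |]// _ _; rewrite ?leey//.
rewrite -!EFinD !lee_fin => h1 h2.
rewrite ler_norml.
by apply/andP; split; lra.
Qed.

Lemma lee_dist_leD a b c : 0 <= b -> `|a - b| <= c -> a <= b + c.
Proof.
case: a => [a| |]//; case: b => [b| |]//; case: c => [c| |]// _; rewrite ?leey ?leNye//=.
by rewrite !lee_fin ler_norml => /andP[_]; rewrite lerBlDl.
Qed.

End ereal_dist.

(** * Smoothed potentials and measurability of the oscillation *)
Section smoothing.
Context {R : realType} {dS dT dZ : measure_display}.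
Context {S : measurableType dS} {T : measurableType dT} {Z : measurableType dZ}.
Variables (m : probability S R) (nu : probability Z R).
Variables (V : S -> T -> 'rV[R]_3) (zeta : Z -> 'rV[R]_3) (C : R).
Hypothesis mV : forall k, measurable_fun setT (fun p : S * T => V p.1 p.2 ord0 k).
Hypothesis mzeta : forall k, measurable_fun setT (fun z => zeta z ord0 k).
Hypothesis zeta_le1 : forall z, enorm3 (zeta z) <= 1.
Hypothesis C_ge0 : 0 <= C.
Hypothesis zeta_ball : forall y rho, 0 < rho ->
  (nu [set z | (enorm3 (y + zeta z) <= rho)%R] <= (C * rho ^+ 2)%:E)%E.

Definition pot w x := (\int[m]_s coulomb (enorm3 (V s w - x)))%E.

Definition smooth_kernel n y :=
  (\int[nu]_z coulomb (enorm3 (y + scale4 n *: zeta z)))%E.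

Definition smooth_pot n w x := (\int[m]_s smooth_kernel n (V s w - x))%E.

Lemma pot_ge0 w x : (0 <= pot w x)%E.
Proof. by apply: integral_ge0 => s _; exact: coulomb_enorm3_ge0. Qed.

Lemma smooth_kernel_ge0 n y : (0 <= smooth_kernel n y)%E.
Proof. by apply: integral_ge0 => s _; exact: coulomb_enorm3_ge0. Qed.

Lemma smooth_pot_ge0 n w x : (0 <= smooth_pot n w x)%E.
Proof. by apply: integral_ge0 => s _; exact: smooth_kernel_ge0. Qed.

Lemma measurable_path w k : measurable_fun setT (fun s => V s w ord0 k).
Proof.
rewrite (_ : (fun s => V s w ord0 k) = (fun p : S * T => V p.1 p.2 ord0 k) \o (fun s => (s, w)))//.
by apply: measurableT_comp => //; exact: measurable_pair2.
Qed.

Lemma measurable_coulomb_path w x :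
  measurable_fun setT ((fun s => coulomb (enorm3 (V s w - x))) : S -> \bar R).
Proof.
apply: measurable_coulomb; first by move=> s; exact: enorm3_ge0.
apply: measurable_enorm3 => k; under eq_fun do rewrite !mxE.
by apply: measurable_funD => //; exact: measurable_path.
Qed.

Lemma measurable_coulomb_shift {d} {X : measurableType d} (f : X -> 'rV[R]_3) (a : R) :
  (forall k, measurable_fun setT (fun x => f x ord0 k)) ->
  measurable_fun setT ((fun p : X * Z => coulomb (enorm3 (f p.1 + a *: zeta p.2)))
    : X * Z -> \bar R).
Proof.
move=> mf; apply: measurable_coulomb; first by move=> s; exact: enorm3_ge0.
apply: measurable_enorm3 => k; under eq_fun do rewrite !mxE.
apply: measurable_funD.
  by apply: measurableT_comp (mf k) measurable_fst.
apply: measurable_funM => //.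
by apply: measurableT_comp (mzeta k) measurable_snd.
Qed.

Lemma measurable_smooth_kernel {d} {X : measurableType d} (f : X -> 'rV[R]_3) n :
  (forall k, measurable_fun setT (fun x => f x ord0 k)) ->
  measurable_fun setT ((fun x => smooth_kernel n (f x)) : X -> \bar R).
Proof.
move=> mf; apply: (@measurable_fun_fubini_tonelli_F _ _ X Z R nu
  (fun p => coulomb (enorm3 (f p.1 + scale4 n *: zeta p.2)))).
  exact: measurable_coulomb_shift.
by move=> p; exact: coulomb_enorm3_ge0.
Qed.

Lemma measurable_smooth_kernel_path n w x :
  measurable_fun setT ((fun s => smooth_kernel n (V s w - x)) : S -> \bar R).
Proof.
apply: measurable_smooth_kernel => k; under eq_fun do rewrite !mxE.
by apply: measurable_funD => //; exact: measurable_path.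
Qed.

Lemma measurable_smooth_pot n x :
  measurable_fun setT ((fun w => smooth_pot n w x) : T -> \bar R).
Proof.
apply: (@measurable_fun_fubini_tonelli_F _ _ T S R m
  (fun p => smooth_kernel n (V p.2 p.1 - x))).
  apply: measurable_smooth_kernel => k; under eq_fun do rewrite !mxE.
  apply: measurable_funD => //.
  rewrite (_ : (fun p : T * S => V p.2 p.1 ord0 k) =
    (fun p : S * T => V p.1 p.2 ord0 k) \o (fun p : T * S => (p.2, p.1)))//.
  apply: measurableT_comp => //.
  by apply/measurable_fun_pair; [exact: measurable_snd|exact: measurable_fst].
by move=> p; exact: smooth_kernel_ge0.
Qed.

Lemma smooth_potE n w x :
  smooth_pot n w x = (\int[nu]_z pot w (x - scale4 n *: zeta z))%E.
Proof.
rewrite /smooth_pot /smooth_kernel /pot.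
rewrite (@fubini_tonelli _ _ S Z R m nu
  (fun p => coulomb (enorm3 (V p.1 w - x + scale4 n *: zeta p.2)))).
- by apply: eq_integral => z _; apply: eq_integral => s _; rewrite opprB addrA addrAC.
- apply: (@measurable_coulomb_shift _ _ (fun s => V s w - x)) => k.
  under eq_fun do rewrite !mxE.
  by apply: measurable_funD => //; exact: measurable_path.
- by move=> p; exact: coulomb_enorm3_ge0.
Qed.

Lemma measurable_pot_shift n w x :
  measurable_fun setT ((fun z => pot w (x - scale4 n *: zeta z)) : Z -> \bar R).
Proof.
rewrite /pot.
rewrite (_ : (fun z => _) = fubini_F m (fun p : Z * S =>
  coulomb (enorm3 (V p.2 w - x + scale4 n *: zeta p.1)))); last first.
  by apply/funext => z; apply: eq_integral => s _ /=; rewrite opprB addrA addrAC.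
apply: measurable_fun_fubini_tonelli_F; last by move=> p; exact: coulomb_enorm3_ge0.
rewrite (_ : (fun p : Z * S => _) =
  (fun p : S * Z => coulomb (enorm3 (V p.1 w - x + scale4 n *: zeta p.2)))
   \o (fun p : Z * S => (p.2, p.1)))//.
apply: measurableT_comp.
  apply: (@measurable_coulomb_shift _ _ (fun s => V s w - x)) => k.
  under eq_fun do rewrite !mxE.
  by apply: measurable_funD => //; exact: measurable_path.
by apply/measurable_fun_pair; [exact: measurable_snd|exact: measurable_fst].
Qed.

Lemma zeta_ball_scaled n y k :
  (nu [set z | (enorm3 (y + scale4 n *: zeta z) <= scale4 k)%R] <=
   (C * (4 ^+ n * scale4 k) ^+ 2)%:E)%E.
Proof.
rewrite (_ : [set z | _] =
  [set z | (enorm3 (4 ^+ n *: y + zeta z) <= 4 ^+ n * scale4 k)%R]).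
  by apply: zeta_ball; rewrite mulr_gt0 ?scale4_gt0// exprn_gt0.
apply/seteqP; split => z /=.
  move=> h; have -> : 4 ^+ n *: y + zeta z = 4 ^+ n *: (y + scale4 n *: zeta z).
    by rewrite scalerDr scalerA -scale4V mulVf ?scale1r// gt_eqF// scale4_gt0.
  by rewrite enorm3Z ger0_norm ?exprn_ge0// ler_pM2l// exprn_gt0.
have -> : 4 ^+ n *: y + zeta z = 4 ^+ n *: (y + scale4 n *: zeta z).
  by rewrite scalerDr scalerA -scale4V mulVf ?scale1r// gt_eqF// scale4_gt0.
by rewrite enorm3Z ger0_norm ?exprn_ge0// ler_pM2l// exprn_gt0.
Qed.

Lemma measurable_shift_norm n y :
  measurable_fun setT (fun z => enorm3 (y + scale4 n *: zeta z)).
Proof.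
apply: measurable_enorm3 => k; under eq_fun do rewrite !mxE.
by apply: measurable_funD => //; apply: measurable_funM.
Qed.

Lemma smooth_kernel_le n k0 y :
  (smooth_kernel n y <=
   \int[nu]_z ((Num.max (enorm3 (y + scale4 n *: zeta z)) (scale4 k0))^-1)%:E +
   (8 * C * 16 ^+ n * scale4 k0)%:E)%E.
Proof.
pose N z := enorm3 (y + scale4 n *: zeta z).
have mN : measurable_fun setT N by exact: measurable_shift_norm.
have ml k : measurable_fun setT (fun z => (layer k (N z))%:E).
  exact: measurable_layer.
have mm : measurable_fun setT (fun z => (Num.max (N z) (scale4 k0))^-1).
  exact/measurable_maxV/mN/scale4_gt0.
have m0 z : (0 <= ((Num.max (N z) (scale4 k0))^-1)%:E)%E.
  by rewrite lee_fin invr_ge0 le_max enorm3_ge0.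
have l0 k z : (0 <= (layer k (N z))%:E)%E by rewrite lee_fin layer_ge0.
have il k : (\int[nu]_z (layer k (N z))%:E <= (4 * C * 16 ^+ n * scale4 k)%:E)%E.
  under eq_integral do rewrite /layer EFinM le_indic.
  have mS : measurable [set z | (N z <= scale4 k)%R] by exact: measurable_le_set.
  rewrite ge0_integralZl// ?lee_fin ?exprn_ge0//; last exact/measurable_EFinP/measurable_indic.
  rewrite integral_indic// setIT.
  apply: (@le_trans _ _ ((4 ^+ k.+1)%:E * (C * (4 ^+ n * scale4 k) ^+ 2)%:E)%E).
    by apply: lee_wpmul2l; [rewrite lee_fin exprn_ge0|exact: zeta_ball_scaled].
  rewrite -EFinM lee_fin le_eqVlt; apply/orP; left; apply/eqP.
  rewrite exprS (_ : 16 = 4 * 4 :> R); last by rewrite -natrM.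
  rewrite !exprMn (_ : scale4 k = (4 ^+ k)^-1); last by rewrite -scale4V invrK.
  by field; rewrite expf_neq0.
apply: (@le_trans _ _ (\int[nu]_z (((Num.max (N z) (scale4 k0))^-1)%:E +
    \sum_(k <oo) (layer (k0 + k) (N z))%:E))%E).
  rewrite /smooth_kernel; apply: ge0_le_integral => //.
  - by move=> z _; exact: coulomb_enorm3_ge0.
  - by apply: measurable_coulomb => // z; exact: enorm3_ge0.
  - apply: emeasurable_funD; first exact/measurable_EFinP.
    exact: ge0_emeasurable_sum.
  - by move=> z _; exact/coulomb_le_layers/enorm3_ge0.
rewrite ge0_integralD//; last 3 first.
  exact/measurable_EFinP.
  by move=> z _; exact: nneseries_ge0.
  exact: ge0_emeasurable_sum.
apply: leeD2l.
rewrite integral_nneseries//.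
apply: nneseries_le => [i|j]; first exact: integral_ge0.
apply: (@le_trans _ _ (\sum_(i < j) (4 * C * 16 ^+ n * scale4 (k0 + i))%:E)%E).
  by apply: lee_sum => i _; exact: il.
rewrite sumEFin lee_fin -mulr_sumr.
under eq_bigr do rewrite /scale4 exprD -/(scale4 _).
rewrite -mulr_sumr.
have := geo4_sum j (R := R); set s := \sum_(_ < _) _ => s2.
rewrite [leRHS](_ : _ = (4 * C * 16 ^+ n * (4^-1 ^+ k0 * 2))); last by rewrite /scale4; ring.
by rewrite ler_wpM2l ?mulr_ge0 ?exprn_ge0// ler_wpM2l ?exprn_ge0 ?invr_ge0.
Qed.

Lemma smooth_kernel_le_cst n y :
  (smooth_kernel n y <= ((1 + 8 * C) * 4 ^+ n)%:E)%E.
Proof.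
apply: (le_trans (smooth_kernel_le n n y)).
have -> : 8 * C * 16 ^+ n * scale4 n = 8 * C * 4 ^+ n.
  rewrite (_ : 16 = 4 * 4 :> R); last by rewrite -natrM.
  rewrite exprMn (_ : scale4 n = (4 ^+ n)^-1); last by rewrite -scale4V invrK.
  by field; rewrite expf_neq0.
rewrite [in leRHS]mulrDl mul1r EFinD; apply: leeD2r.
apply: probability_integral_le.
- exact/measurable_EFinP/measurable_maxV/measurable_shift_norm/scale4_gt0.
- by move=> z; rewrite lee_fin invr_ge0 le_max enorm3_ge0.
- move=> z; rewrite lee_fin -scale4V lef_pV2 ?posrE ?scale4_gt0//.
    by rewrite le_max lexx orbT.
  by rewrite lt_max scale4_gt0 orbT.
Qed.

Lemma measurable_coulomb_zeta n y :
  measurable_fun setT ((fun z => coulomb (enorm3 (y + scale4 n *: zeta z))) : Z -> \bar R).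
Proof.
apply: measurable_coulomb; last exact: measurable_shift_norm.
by move=> z; exact: enorm3_ge0.
Qed.

Lemma shift_norm_bounds n y z :
  enorm3 y - scale4 n <= enorm3 (y + scale4 n *: zeta z) <= enorm3 y + scale4 n.
Proof.
have h : enorm3 (scale4 n *: zeta z) <= scale4 n.
  by rewrite enorm3Z ger0_norm ?scale4_ge0// ler_piMr ?scale4_ge0.
apply/andP; split; last by rewrite (le_trans (ler_enorm3D _ _))// lerD2l.
have := ler_enorm3D (y + scale4 n *: zeta z) (- (scale4 n *: zeta z)).
by rewrite addrK enorm3N; lra.
Qed.

Lemma smooth_kernel_le_far n y : 0 < enorm3 y - scale4 n ->
  (smooth_kernel n y <= ((enorm3 y - scale4 n)^-1)%:E)%E.
Proof.
move=> h; apply: probability_integral_le.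
- exact: measurable_coulomb_zeta.
- by move=> z; exact: coulomb_enorm3_ge0.
- move=> z; have /andP[h1 _] := shift_norm_bounds n y z.
  apply: (le_trans (le_coulomb (ltW h) h1)).
  by rewrite /coulomb gt_eqF.
Qed.

Lemma smooth_kernel_ge n y :
  (((enorm3 y + scale4 n)^-1)%:E <= smooth_kernel n y)%E.
Proof.
have h : 0 < enorm3 y + scale4 n by rewrite ltr_wpDl ?enorm3_ge0 ?scale4_gt0.
apply: probability_integral_ge.
- exact: measurable_coulomb_zeta.
- by rewrite lee_fin invr_ge0 ltW.
- move=> z; have /andP[_ h1] := shift_norm_bounds n y z.
  apply: (le_trans _ (le_coulomb (enorm3_ge0 _) h1)).
  by rewrite /coulomb gt_eqF.
Qed.

Lemma smooth_kernel_le_coulomb n y :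
  (smooth_kernel n y <= (2 * (1 + 8 * C))%:E * coulomb (enorm3 y))%E.
Proof.
have [y0|yn0] := eqVneq (enorm3 y) 0.
  rewrite /coulomb y0 eqxx gt0_muley ?leey// lte_fin; have := C_ge0; lra.
have yp : 0 < enorm3 y by rewrite lt_neqAle eq_sym yn0 enorm3_ge0.
rewrite /coulomb (negbTE yn0) -EFinM.
have [h|h] := leP (2 * scale4 n) (enorm3 y).
  have sp := @scale4_gt0 R n.
  have h' : 0 < enorm3 y - scale4 n by lra.
  apply: (le_trans (smooth_kernel_le_far h')); rewrite lee_fin.
  rewrite -[leLHS]mul1r ler_pdivrMr// mulrAC ler_pdivlMr// mul1r.
  by have := C_ge0; nra.
apply: (le_trans (smooth_kernel_le_cst n y)); rewrite lee_fin -scale4V.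
rewrite ler_pdivlMr// mulrAC ler_pdivrMr ?scale4_gt0//.
rewrite -[leRHS]mulrA mulrCA mulrA [leLHS]mulrC -[leRHS]mulrA mulrCA.
have := C_ge0; nra.
Qed.

Lemma smooth_kernel_cvg y :
  smooth_kernel n y @[n --> \oo] --> coulomb (enorm3 y).
Proof.
have [y0|yn0] := eqVneq (enorm3 y) 0.
  rewrite /coulomb y0 eqxx; apply/cvgeyPge => A.
  have Ap : 0 < (Num.max A 1)^-1 by rewrite invr_gt0 lt_max ltr01 orbT.
  have /cvgrPdist_lt/(_ _ Ap) := @scale4_cvg0 R.
  apply: filterS => n; rewrite sub0r normrN gtr0_norm ?scale4_gt0// => sA.
  apply: (le_trans _ (smooth_kernel_ge n y)); rewrite lee_fin y0 add0r.
  apply: (@le_trans _ _ (Num.max A 1)); first by rewrite le_max lexx.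
  by rewrite -[leLHS]invrK lef_pV2 ?posrE ?scale4_gt0// ltW.
have yp : 0 < enorm3 y by rewrite lt_neqAle eq_sym yn0 enorm3_ge0.
have cc (f : nat -> R) : f n @[n --> \oo] --> enorm3 y ->
    ((f n)^-1)%:E @[n --> \oo] --> coulomb (enorm3 y).
  move=> cf; rewrite /coulomb (negbTE yn0); apply: cvg_EFin; first exact: nearW.
  exact: cvgV.
apply: (@squeeze_cvge _ _ _ _ (fun n => ((enorm3 y + scale4 n)^-1)%:E) _
    (fun n => ((enorm3 y - scale4 n)^-1)%:E)).
- have /cvgrPdist_lt/(_ _ yp) := @scale4_cvg0 R.
  apply: filterS => n; rewrite sub0r normrN gtr0_norm ?scale4_gt0// => sA.
  by rewrite smooth_kernel_ge smooth_kernel_le_far// subr_gt0.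
- by apply: cc; rewrite -[X in _ --> X]addr0; apply: cvgD; [exact: cvg_cst|exact: scale4_cvg0].
- by apply: cc; rewrite -[X in _ --> X]subr0; apply: cvgB; [exact: cvg_cst|exact: scale4_cvg0].
Qed.

Lemma smooth_kernel_uniform n e : 0 < e -> exists2 del : R, 0 < del &
  forall y1 y2, enorm3 (y1 - y2) <= del ->
    (smooth_kernel n y1 <= smooth_kernel n y2 + e%:E)%E.
Proof.
move=> e0.
have Kp : 0 < 16 * (1 + C) * 16 ^+ n.
  by rewrite mulr_gt0 ?exprn_gt0// mulr_gt0// ltr_pwDl.
have /scale4_lt[k0 hk0] : 0 < e / (16 * (1 + C) * 16 ^+ n) by rewrite divr_gt0.
have tail : 8 * C * 16 ^+ n * scale4 k0 <= e / 2.
  move: hk0; rewrite ltr_pdivlMr// => hk0.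
  have : 0 < 16 ^+ n * scale4 k0 :> R by rewrite mulr_gt0 ?scale4_gt0 ?exprn_gt0.
  by move: hk0; rewrite mulrC -!mulrA; set X := _ ^+ n * _; nra.
have sp := @scale4_gt0 R k0.
exists (e / 2 * scale4 k0 ^+ 2); first by rewrite mulr_gt0 ?exprn_gt0// divr_gt0.
move=> y1 y2 y12; apply: (le_trans (smooth_kernel_le n k0 y1)).
pose F y z := ((Num.max (enorm3 (y + scale4 n *: zeta z)) (scale4 k0))^-1)%:E.
have mF y : measurable_fun setT (F y).
  exact/measurable_EFinP/measurable_maxV/measurable_shift_norm/scale4_gt0.
have F0 y z : (0 <= F y z)%E by rewrite lee_fin invr_ge0 le_max enorm3_ge0.
apply: (@le_trans _ _ ((\int[nu]_z F y2 z + (e / 2)%:E) + (e / 2)%:E)%E).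
  apply: leeD; last by rewrite lee_fin.
  have e20 : (0 <= (e / 2)%:E :> \bar R)%E by rewrite lee_fin ltW// divr_gt0.
  rewrite -probability_integralDc//.
  apply: ge0_le_integral => //.
  - by move=> z _; exact: (F0 y1 z).
  - exact: (mF y1).
  - by apply: emeasurable_funD.
  move=> z _; rewrite /F -EFinD lee_fin;
    apply: (le_trans (maxV_lip _ (enorm3 (y2 + scale4 n *: zeta z)) sp)).
  rewrite lerD2l ler_pdivrMr ?exprn_gt0//; apply: le_trans y12.
  apply: (le_trans (ler_enorm3_dist _ _)).
  by rewrite opprD addrACA subrr addr0.
rewrite -addeA -EFinD -splitr leeD2r//.
apply: ge0_le_integral => //; first exact: measurable_coulomb_zeta.
by move=> z _; apply: maxV_le_coulomb => //; exact: enorm3_ge0.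
Qed.

Lemma smooth_pot_uniform n w e : 0 < e -> exists2 del : R, 0 < del &
  forall x1 x2, enorm3 (x1 - x2) <= del ->
    (smooth_pot n w x1 <= smooth_pot n w x2 + e%:E)%E.
Proof.
move=> e0; have [del del0 hdel] := smooth_kernel_uniform n e0.
exists del => // x1 x2 x12.
have mk x := measurable_smooth_kernel_path n w x.
rewrite -probability_integralDc//; last 2 first.
  by move=> s; exact: smooth_kernel_ge0.
  by rewrite lee_fin ltW.
apply: ge0_le_integral => //.
- by move=> s _; exact: smooth_kernel_ge0.
- by apply: emeasurable_funD.
- move=> s _; apply: hdel.
  have -> : V s w - x1 - (V s w - x2) = x2 - x1.
    by rewrite opprB addrC addrA subrK.
  by rewrite enorm3_distC.
Qed.

Lemma smooth_pot_fin n w x : smooth_pot n w x \is a fin_num.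
Proof.
rewrite ge0_fin_numE ?smooth_pot_ge0//.
apply: (@le_lt_trans _ _ ((1 + 8 * C) * 4 ^+ n)%:E); last exact: ltry.
apply: probability_integral_le.
- exact: measurable_smooth_kernel_path.
- by move=> s; exact: smooth_kernel_ge0.
- by move=> s; exact: smooth_kernel_le_cst.
Qed.

Definition osc w (delta : R) :=
  ereal_sup [set `|pot w p.1 - pot w p.2|%E |
    p in [set p : 'rV[R]_3 * 'rV[R]_3 | (enorm3 (p.1 - p.2) <= delta)%R]].

Lemma osc_ge w delta x1 x2 : enorm3 (x1 - x2) <= delta ->
  (`|pot w x1 - pot w x2| <= osc w delta)%E.
Proof. by move=> h; apply: ereal_sup_ubound; exists (x1, x2). Qed.

Lemma osc_ge0 w delta : 0 <= delta -> (0 <= osc w delta)%E.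
Proof.
move=> d0; apply: le_trans (abse_ge0 _) (@osc_ge w delta 0 0 _).
by rewrite subrr enorm3_0.
Qed.

Lemma smooth_pot_osc w delta n x1 x2 : enorm3 (x1 - x2) <= delta ->
  (`|smooth_pot n w x1 - smooth_pot n w x2| <= osc w delta)%E.
Proof.
have key y1 y2 : enorm3 (y1 - y2) <= delta ->
    (smooth_pot n w y1 <= smooth_pot n w y2 + osc w delta)%E.
  move=> y12; rewrite !smooth_potE.
  have m1 := measurable_pot_shift n w y1; have m2 := measurable_pot_shift n w y2.
  have o0 : (0 <= osc w delta)%E by apply/osc_ge0/le_trans/y12/enorm3_ge0.
  rewrite -probability_integralDc//; last by move=> z; exact: pot_ge0.
  apply: ge0_le_integral; [exact: measurableT| |exact: m1| |].
    by move=> z _; exact: pot_ge0.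
    exact: (emeasurable_funD m2 (measurable_cst _)).
  move=> z _; apply: lee_dist_leD; first exact: pot_ge0.
  apply: osc_ge.
  have -> : y1 - scale4 n *: zeta z - (y2 - scale4 n *: zeta z) = y1 - y2.
    by rewrite opprB addrA subrK.
  by [].
move=> x12; apply: lee_dist; rewrite ?smooth_pot_fin//; apply: key => //.
by rewrite enorm3_distC.
Qed.

Lemma rational_approx (x : 'rV[R]_3) e : 0 < e ->
  exists q : 'rV[rat]_3, enorm3 (x - map_mx ratr q) <= e.
Proof.
move=> e0.
have /choice[f hf] (k : 'I_3) : exists q : rat, `|x ord0 k - ratr q| <= e / 2.
  have [] := @rat_in_itvoo R (x ord0 k - e / 2) (x ord0 k + e / 2); first lra.
  move=> q; rewrite in_itv/= => /andP[h1 h2]; exists q.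
  by rewrite ler_norml; apply/andP; split; lra.
exists (\row_k f k).
rewrite [leRHS](_ : e = 2 * (e / 2)); last by rewrite mulrC divfK.
by apply: enorm3_le_coord => k; rewrite !mxE.
Qed.

Lemma smooth_pot_dense w delta M n : 0 < delta ->
  (forall q1 q2 : 'rV[rat]_3,
    enorm3 (map_mx ratr q1 - map_mx ratr q2 : 'rV[R]_3) <= delta ->
    (`|smooth_pot n w (map_mx ratr q1) - smooth_pot n w (map_mx ratr q2)| <= M)%E) ->
  forall x1 x2, enorm3 (x1 - x2) <= delta ->
    (smooth_pot n w x1 <= smooth_pot n w x2 + M)%E.
Proof.
move=> d0 hM x1 x2 x12.
apply/lee_addgt0Pr => e e0.
have [del del0 hdel] := smooth_pot_uniform n w (divr_gt0 e0 (ltr0n _ 2)).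
(* [x2] is first moved towards [x1] so that the rational approximations stay
   within distance [delta]. *)
pose c := Num.min 2^-1 (del / (2 * delta)).
have c0 : 0 < c by rewrite lt_min invr_gt0 ltr0n/= divr_gt0// mulr_gt0.
have c2 : c <= 2^-1 by rewrite ge_min lexx.
have cdel : c * delta <= del / 2.
  apply: (@le_trans _ _ (del / (2 * delta) * delta)).
    by apply: ler_wpM2r; [exact: ltW|rewrite ge_min lexx orbT].
  by rewrite le_eqVlt; apply/orP; left; apply/eqP; field; rewrite gt_eqF.
pose y2 := x2 + c *: (x1 - x2).
have x1y2 : enorm3 (x1 - y2) <= (1 - c) * delta.
  have -> : x1 - y2 = (1 - c) *: (x1 - x2).
    by rewrite /y2 opprD addrA scalerBl scale1r.
  by rewrite enorm3Z ger0_norm ?ler_wpM2l//; lra.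
have x2y2 : enorm3 (y2 - x2) <= c * delta.
  rewrite /y2 addrAC subrr add0r enorm3Z gtr0_norm//.
  by rewrite ler_wpM2l// ltW.
clearbody y2.
pose g := c * delta / 2.
have g0 : 0 < g by rewrite divr_gt0// mulr_gt0.
have [q1 hq1] := rational_approx x1 g0.
have [q2 hq2] := rational_approx y2 g0.
have q12 : enorm3 (map_mx ratr q1 - map_mx ratr q2 : 'rV[R]_3) <= delta.
  have := ler_enorm3D (map_mx ratr q1 - x1) (x1 - y2 + (y2 - map_mx ratr q2)).
  have := ler_enorm3D (x1 - y2) (y2 - map_mx ratr q2).
  rewrite !addrA !subrK; move: hq1; rewrite enorm3_distC.
  move: hq2 x1y2; rewrite /g; lra.
have h1 : (smooth_pot n w x1 <= smooth_pot n w (map_mx ratr q1) + (e / 2)%:E)%E.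
  by apply: hdel; apply: (le_trans hq1); rewrite /g; lra.
have h2 : (smooth_pot n w (map_mx ratr q2) <= smooth_pot n w x2 + (e / 2)%:E)%E.
  apply: hdel; have := ler_enorm3D (map_mx ratr q2 - y2) (y2 - x2).
  rewrite addrA subrK; move: hq2 x2y2; rewrite enorm3_distC /g; lra.
have h3 := lee_dist_leD (smooth_pot_ge0 _ _ _) (hM _ _ q12).
apply: (le_trans h1); apply: (le_trans (leeD2r _ h3)).
apply: (le_trans (leeD2r _ (leeD2r _ h2))).
have -> : e%:E = ((e / 2)%:E + (e / 2)%:E)%E by rewrite -EFinD -splitr.
by rewrite addeA (addeAC _ _ M).
Qed.

Lemma pot_le_lim w x (u : R) : (\forall n \near \oo, smooth_pot n w x <= u%:E)%E ->
  (pot w x <= u%:E)%E.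
Proof.
move=> hu.
apply: (@le_trans _ _ (limn_einf (fun n => smooth_pot n w x))).
  have := @fatou _ S R m setT measurableT (fun n s => smooth_kernel n (V s w - x)).
  move=> /(_ (fun n => measurable_smooth_kernel_path n w x)
    (fun n s _ => smooth_kernel_ge0 n _)).
  apply: le_trans; rewrite le_eqVlt; apply/orP; left; apply/eqP.
  apply: eq_integral => s _.
  have c := @smooth_kernel_cvg (V s w - x).
  rewrite is_cvg_limn_einfE; last by apply/cvg_ex; eexists; exact: c.
  by apply/esym/cvg_lim => //; exact: c.
case: hu => N _ hN; rewrite limn_einf_lim; apply: lime_le.
  exact: is_cvg_einfs.
apply: nearW => k; apply: ereal_inf_le; exists (smooth_pot (k + N)%N w x).
  by exists (k + N)%N => //=; exact: leq_addr.
by apply: hN => /=; exact: leq_addl.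
Qed.

Lemma smooth_pot_cvg w x : (pot w x < +oo)%E ->
  smooth_pot n w x @[n --> \oo] --> pot w x.
Proof.
move=> fx.
have ip : m.-integrable setT (fun s => coulomb (enorm3 (V s w - x))).
  apply/integrableP; split; first exact: measurable_coulomb_path.
  by under eq_integral do rewrite gee0_abs ?coulomb_enorm3_ge0//.
have [|_ _] := @dominated_convergence _ S R m setT measurableT
  (fun n s => smooth_kernel n (V s w - x))
  (fun s => coulomb (enorm3 (V s w - x)))
  (fun s => (2 * (1 + 8 * C))%:E * coulomb (enorm3 (V s w - x)))%E
  (fun n => measurable_smooth_kernel_path n w x)
  (measurable_coulomb_path w x)
  (aeW m (fun s _ => @smooth_kernel_cvg (V s w - x)))
  (integrableZl measurableT _ ip).
  apply: aeW => s n _.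
  by rewrite gee0_abs ?smooth_kernel_ge0// smooth_kernel_le_coulomb.
by [].
Qed.

Lemma pot_osc_le w delta M : 0 < delta ->
  (forall n (q1 q2 : 'rV[rat]_3),
    enorm3 (map_mx ratr q1 - map_mx ratr q2 : 'rV[R]_3) <= delta ->
    (`|smooth_pot n w (map_mx ratr q1) - smooth_pot n w (map_mx ratr q2)| <= M)%E) ->
  (osc w delta <= M)%E.
Proof.
move=> d0 hM.
have M0 : (0 <= M)%E.
  by apply: le_trans (abse_ge0 _) (hM 0%N 0 0 _); rewrite subrr enorm3_0 ltW.
case: M M0 hM => [M| |]// M0 hM; last by rewrite leey.
have step x1 x2 : enorm3 (x1 - x2) <= delta -> (pot w x1 <= pot w x2 + M%:E)%E.
  move=> x12; have [fx2|] := ltP (pot w x2) +oo%E; last first.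
    by rewrite leye_eq => /eqP ->; rewrite addye ?leey.
  have fp : pot w x2 \is a fin_num by rewrite ge0_fin_numE ?pot_ge0.
  apply/lee_addgt0Pr => e e0.
  rewrite -(fineK fp) -!EFinD; apply: pot_le_lim.
  have := smooth_pot_cvg fx2; rewrite -{1}(fineK fp) => /fine_cvgP[_].
  move=> /cvgr_lt/(_ (fine (pot w x2) + e)); rewrite ltrDl => /(_ e0).
  apply: filterS => n /= hn.
  apply: (le_trans (smooth_pot_dense d0 (hM n) x12)).
  by rewrite -(fineK (smooth_pot_fin n w x2)) -EFinD lee_fin; move: hn; lra.
have fin x : pot w x \is a fin_num.
  rewrite ge0_fin_numE ?pot_ge0//.
  have [n hn] := scale4_lt d0.
  have [z hz] : exists z, (pot w (x - scale4 n *: zeta z) < +oo)%E.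
    apply: contrapT => /forallNP hz.
    have := smooth_pot_fin n w x; rewrite smooth_potE.
    rewrite (_ : (fun z => _) = cst +oo%E); last first.
      by apply/funext => z /=; apply/eqP; rewrite -leye_eq leNgt; apply/negP.
    rewrite integral_cst// [X in (_ * X)%E](probability_setT nu) mule1.
    by [].
  apply: (le_lt_trans (step x (x - scale4 n *: zeta z) _)); last first.
    by rewrite lte_add_pinfty// ltry.
  rewrite opprB addrC subrK enorm3Z ger0_norm ?scale4_ge0//.
  by apply: le_trans (ltW hn); rewrite ler_piMr ?scale4_ge0.
apply: ge_ereal_sup => _ [[x1 x2] /= x12 <-].
by apply: lee_dist; rewrite ?fin//; apply: step => //; rewrite enorm3_distC.
Qed.

Lemma measurable_osc delta b : 0 < delta ->
  measurable [set w | (b%:E <= osc w delta)%E].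
Proof.
move=> d0.
pose I : countType := (nat * 'rV[rat]_3 * 'rV[rat]_3)%type.
pose D := [set i : I | enorm3 (map_mx ratr i.1.2 - map_mx ratr i.2 : 'rV[R]_3) <= delta].
pose a (i : I) w := `|smooth_pot i.1.1 w (map_mx ratr i.1.2) -
                      smooth_pot i.1.1 w (map_mx ratr i.2)|%E.
have oscE w : osc w delta = ereal_sup [set a i w | i in D].
  apply/eqP; rewrite eq_le; apply/andP; split.
    apply: pot_osc_le => // n q1 q2 q12; apply: ereal_sup_ubound.
    by exists (n, q1, q2).
  by apply: ge_ereal_sup => _ [i Di <-]; exact: smooth_pot_osc.
rewrite (_ : [set w | _] = \bigcap_(j : nat) \bigcup_(i : I)
    (if i \in D then [set w | ((b - j.+1%:R^-1)%:E < a i w)%E] else set0)).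
  apply: bigcapT_measurable => j; apply: countable_bigcupT_measurable => [|i].
    exact: (@countableP I).
  case: ifP => // _; rewrite -[X in measurable X]setTI.
  apply: emeasurable_fun_o_infty => //.
  apply: measurableT_comp => //.
  by apply: emeasurable_funB; exact: measurable_smooth_pot.
apply/seteqP; split => w /=.
  rewrite oscE => bw j _.
  have : ((b - j.+1%:R^-1)%:E < ereal_sup [set a i w | i in D])%E.
    by apply: lt_le_trans bw; rewrite lte_fin ltrBlDr ltrDl invr_gt0.
  by move=> /ereal_sup_gt[_ [i Di <-] h]; exists i => //; rewrite mem_set.
move=> h; rewrite oscE; apply/lee_addgt0Pr => e e0.
have [j] := ltr_add_invr e0; rewrite add0r => hj.
have [i _] := h j Logic.I; case: ifP => // /set_mem Di /= hi.
apply: (@le_trans _ _ ((b - j.+1%:R^-1)%:E + e%:E)%E).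
  by rewrite -EFinD lee_fin; move: hj; set u := _^-1; lra.
by apply: leeD2r; apply: (le_trans (ltW hi)); apply: ereal_sup_ubound; exists i.
Qed.

End smoothing.

Section joint_measurability.
Context {R : realType} {d : measure_display} {T : measurableType d}.

Lemma measurable_continuous_paths (U : R -> T -> R) :
  (forall w, continuous (U ^~ w)) -> (forall s, measurable_fun setT (U s)) ->
  measurable_fun setT (fun p : R * T => U p.1 p.2).
Proof.
move=> cU mU.
pose step n (s : R) : R := (Num.floor (s * n.+1%:R))%:~R / n.+1%:R.
apply: (@measurable_fun_cvg _ _ _ _ (fun n (p : R * T) => U (step n p.1) p.2)).
  move=> n _ B mB; rewrite setTI.
  rewrite (_ : _ @^-1` _ = \bigcup_(k : int)
    ([set s : R | k%:~R <= s * n.+1%:R < (k + 1)%:~R] `*`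
     [set w | B (U (k%:~R / n.+1%:R) w)])).
    apply: countable_bigcupT_measurable => [|k]; first exact: countableP.
    apply: measurableX.
      rewrite (_ : [set s | _] = `[k%:~R / n.+1%:R, (k + 1)%:~R / n.+1%:R[%classic).
        exact: measurable_itv.
      apply/seteqP; split => s /=; rewrite in_itv/=;
        by rewrite ler_pdivrMr// ltr_pdivlMr.
    by rewrite -[X in measurable X]setTI; exact: mU.
  apply/seteqP; split => [[s w] /= Bsw|[s w] [k _ [/= h Bk]]].
    by exists (Num.floor (s * n.+1%:R)) => //; split => //=; exact: floor_itv.
  suff -> : step n s = k%:~R / n.+1%:R by [].
  by rewrite /step (floor_def h).
move=> [s w] _ /=.
have st : step n s @[n --> \oo] --> s.
  apply: (@squeeze_cvgr _ _ _ _ (fun n => s - n.+1%:R^-1) (fun=> s)).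
  - apply: nearW => n; have /andP[h1 h2] := floor_itv (s * n.+1%:R).
    rewrite /step ler_pdivrMr// h1 andbT ler_pdivlMr// mulrBl mulVf//.
    by move: h2; rewrite intrD; lra.
  - rewrite -[X in _ --> X]subr0; apply: cvgB; first exact: cvg_cst.
    exact: cvg_harmonic.
  - exact: cvg_cst.
exact: (cvg_comp _ _ st (cU w s)).
Qed.

End joint_measurability.

(** * Chains of close increments and occupation times *)
Section chains.
Context {R : realType} {d : measure_display} {T : measurableType d}.
Variables (P : probability T R) (W : R -> T -> 'rV[R]_3).
Hypothesis mW : forall k, measurable_fun setT (fun p : R * T => W p.1 p.2 ord0 k).
Hypothesis fddW : forall (n : nat) (tt : nat -> R) (A : nat -> 'I_3 -> set R),
  tt 0%N = 0 ->
  (forall i, (i < n)%N -> tt i < tt i.+1) ->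
  (forall i k, measurable (A i k)) ->
  P [set w | forall i (k : 'I_3), (i < n)%N ->
               A i k ((W (tt i.+1) w - W (tt i) w) ord0 k)] =
  (\prod_(i < n) \prod_(k < 3)
      normal_prob 0 (Num.sqrt (tt i.+1 - tt i)) (A i k))%E.
Variable rho : R.
Hypothesis rho_gt0 : 0 < rho.

(* Small enough for the induction of [psi_expectation] to close by telescoping
   (see [chain_rate_telescope]); the factor [4 ^+ 3] comes from the peak of the
   Gaussian density in each of the three coordinates. *)
Definition chain_rate : R := (12 * 4 ^+ 3)^-1.

Definition mesh_time (u : R) (j : nat) : R := j%:R * rho ^+ 2 + u.

Definition cube : set R := `[- (2 * rho), 2 * rho]%classic.

Definition close_incr (v : 'rV[R]_3) : R :=
  \prod_(k < 3) \1_cube (v ord0 k).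

Definition close (u : R) (i j : nat) (w : T) : R :=
  close_incr (W (mesh_time u j) w - W (mesh_time u i) w).

(* Expanding [psi] gives the sum of [chain_rate ^ #|S|] over all subsets [S] of
   the [n] indices from [j] on such that the increments of [W] between
   consecutive elements of [last :: S] are all close. *)
Fixpoint psi (n j last : nat) (u : R) (w : T) : R :=
  if n is n'.+1 then
    psi n' j.+1 last u w + chain_rate * (close u last j w * psi n' j.+1 j u w)
  else 1.

Fixpoint chain_sum (n i : nat) (u : R) (w : T) : R :=
  if n is n'.+1 then
    chain_sum n' i.+1 u w + (1 + chain_rate) * psi n' i.+1 i u w
  else 1.

Lemma chain_rate_gt0 : 0 < chain_rate.
Proof. by rewrite invr_gt0 mulr_gt0// exprn_gt0. Qed.

Lemma close_incr_ge0 v : 0 <= close_incr v.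
Proof. by apply: prodr_ge0 => k _; rewrite indicE. Qed.

Lemma psi_ge0 n j last u w : 0 <= psi n j last u w.
Proof.
elim: n j last => [//|n ih] j last /=.
rewrite addr_ge0// mulr_ge0 ?(ltW chain_rate_gt0)// mulr_ge0//.
exact: close_incr_ge0.
Qed.

Lemma chain_sum_ge0 n i u w : 0 <= chain_sum n i u w.
Proof.
elim: n i => [//|n ih] i /=.
by rewrite addr_ge0// mulr_ge0 ?psi_ge0// addr_ge0// ltW// chain_rate_gt0.
Qed.

Lemma measurable_close i j :
  measurable_fun setT (fun p : R * T => close p.1 i j p.2).
Proof.
have mWs l k : measurable_fun setT (fun p : R * T => W (mesh_time p.1 l) p.2 ord0 k).
  rewrite (_ : (fun p : R * T => _) = (fun p : R * T => W p.1 p.2 ord0 k) \o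
    (fun p : R * T => (mesh_time p.1 l, p.2)))//.
  apply: measurableT_comp => //; apply/measurable_fun_pair => /=.
    by apply: measurable_funD => //; exact: measurable_fst.
  exact: measurable_snd.
apply: measurable_prod => k _.
apply: (@measurableT_comp _ _ _ _ _ _ (\1_cube : R -> R)).
  by apply: measurable_indic; exact: measurable_itv.
by under eq_fun do rewrite !mxE; apply: measurable_funB.
Qed.

Lemma measurable_psi n j last :
  measurable_fun setT (fun p : R * T => psi n j last p.1 p.2).
Proof.
elim: n j last => [|n ih] j last /=; first exact: measurable_cst.
apply: measurable_funD => //; apply: measurable_funM => //.
by apply: measurable_funM => //; exact: measurable_close.
Qed.

Lemma measurable_chain_sum n i :
  measurable_fun setT (fun p : R * T => chain_sum n i p.1 p.2).
Proof.
elim: n i => [|n ih] i /=; first exact: measurable_cst.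
by apply: measurable_funD => //; apply: measurable_funM => //; exact: measurable_psi.
Qed.

Lemma measurable_section {d'} {Y : measurableType d'} (f : R -> T -> Y) u :
  measurable_fun setT (fun p : R * T => f p.1 p.2) -> measurable_fun setT (f u).
Proof.
move=> mf; rewrite (_ : f u = (fun p : R * T => f p.1 p.2) \o (fun w => (u, w)))//.
by apply: measurableT_comp => //; exact: measurable_pair1.
Qed.

Definition incr_event n (tt : nat -> R) (A : nat -> 'I_3 -> set R) :=
  [set w | forall i (k : 'I_3), (i < n)%N ->
             A i k ((W (tt i.+1) w - W (tt i) w) ord0 k)].

Lemma measurable_incr_event n tt A : (forall i k, measurable (A i k)) ->
  measurable (incr_event n tt A).
Proof.
move=> mA.
rewrite (_ : incr_event n tt A = \bigcap_i \bigcap_(k : 'I_3)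
   (if (i < n)%N then (fun w => (W (tt i.+1) w - W (tt i) w) ord0 k) @^-1` A i k
    else setT)).
  apply: bigcapT_measurable => i; apply: fin_bigcap_measurable.
    exact: finite_finset.
  move=> k _; case: ifP => // _; rewrite -[X in measurable X]setTI.
  have m s : measurable_fun setT (fun w => W s w ord0 k).
    exact: (measurable_section (f := fun s w => W s w ord0 k)).
  have : measurable_fun setT (fun w => (W (tt i.+1) w - W (tt i) w) ord0 k).
    by under eq_fun do rewrite !mxE; apply: measurable_funB.
  by move=> /(_ measurableT _ (mA i k)).
apply/seteqP; split => w /= h.
  by move=> i _ k _; case: ifP => // ilt; exact: h.
by move=> i k ilt; have := h i Logic.I k Logic.I; rewrite ilt.
Qed.

Lemma normal_prob_cube_le (l : nat) : (0 < l)%N ->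
  (\prod_(k < 3) normal_prob 0%R (Num.sqrt (l%:R * rho ^+ 2)) cube <=
   (4 ^+ 3 / (l%:R * Num.sqrt l%:R))%:E)%E.
Proof.
move=> l0; have lp : 0 < l%:R :> R by rewrite ltr0n.
have sl : 0 < Num.sqrt l%:R :> R by rewrite sqrtr_gt0.
have sE : Num.sqrt (l%:R * rho ^+ 2) = Num.sqrt l%:R * rho.
  by rewrite sqrtrM ?ler0n// sqrtr_sqr gtr0_norm.
have s0 : Num.sqrt (l%:R * rho ^+ 2) != 0 by rewrite sE mulf_neq0 ?gt_eqF.
have peak : normal_peak (Num.sqrt (l%:R * rho ^+ 2)) <= (Num.sqrt l%:R * rho)^-1.
  rewrite /normal_peak lef_pV2 ?posrE ?mulr_gt0//; last first.
    by rewrite sqrtr_gt0 pmulrn_lgt0// mulr_gt0 ?pi_gt0// exprn_even_gt0.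
  rewrite -[leLHS]gtr0_norm ?mulr_gt0// -sqrtr_sqr ler_sqrt; last first.
    by rewrite mulrn_wge0// mulr_ge0 ?pi_ge0// sqr_ge0.
  rewrite sE -mulrnAr ler_peMr ?sqr_ge0//.
  by have := pi_ge2 R; lra.
have one : (normal_prob 0%R (Num.sqrt (l%:R * rho ^+ 2)) cube <=
            (4 / Num.sqrt l%:R)%:E)%E.
  apply: (@le_trans _ _ (\int[lebesgue_measure]_(x in cube)
     (cst ((Num.sqrt l%:R * rho)^-1)%:E x))%E).
    apply: ge0_le_integral => //.
    - exact: measurable_itv.
    - by move=> x _; rewrite lee_fin normal_pdf_ge0.
    - by apply/measurable_EFinP/measurable_funTS; exact: measurable_normal_pdf.
    - by move=> x _ /=; rewrite lee_fin; apply: le_trans peak; exact: normal_pdf_ub.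
  rewrite integral_cst; last exact: measurable_itv.
  rewrite /= /cube lebesgue_measure_itv/= lte_fin ifT; last by have := rho_gt0; lra.
  rewrite -EFinD -EFinM lee_fin le_eqVlt; apply/orP; left; apply/eqP.
  by field; rewrite !gt_eqF.
rewrite !big_ord_recl big_ord0 mule1.
have n0 : (0 <= normal_prob 0%R (Num.sqrt (l%:R * rho ^+ 2)) cube)%E by [].
apply: (le_trans (lee_pmul n0 (mule_ge0 n0 n0) one (lee_pmul n0 n0 one one))).
rewrite -!EFinM lee_fin le_eqVlt; apply/orP; left; apply/eqP.
have lE : l%:R = Num.sqrt l%:R ^+ 2 :> R by rewrite sqr_sqrtr// ler0n.
move: lE sl; set y := Num.sqrt l%:R => -> y0.
by field; rewrite gt_eqF.
Qed.

Lemma rsqrt_telescope (l : nat) : (0 < l)%N ->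
  (6 * (l%:R * Num.sqrt l%:R))^-1 <= (Num.sqrt l%:R)^-1 - (Num.sqrt l.+1%:R)^-1 :> R.
Proof.
move=> l0; have lp : 0 < l%:R :> R by rewrite ltr0n.
set x := Num.sqrt l%:R; set y := Num.sqrt l.+1%:R.
have x0 : 0 < x by rewrite sqrtr_gt0.
have y0 : 0 < y by rewrite sqrtr_gt0.
have x2 : x ^+ 2 = l%:R by rewrite sqr_sqrtr// ler0n.
have y2 : y ^+ 2 = x ^+ 2 + 1 by rewrite sqr_sqrtr ?ler0n// x2 natr1.
have x1 : 1 <= x by rewrite -sqrtr1 ler_sqrt// ler1n.
have yx : y <= 2 * x.
  by rewrite -(@ler_pXn2r _ 2)// ?nnegrE ?ltW// ?mulr_gt0// y2; nra.
have xy : x < y by rewrite -(@ltr_pXn2r _ 2)// ?nnegrE ?ltW// y2 ltrDl.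
have -> : x^-1 - y^-1 = (y - x) / (x * y) by field; rewrite !gt_eqF.
rewrite -x2 -[leLHS]mul1r ler_pdivrMr ?mulr_gt0 ?exprn_gt0// mulrAC.
rewrite ler_pdivlMr ?mulr_gt0// mul1r.
have h : (y - x) * (y + x) = 1 by rewrite -subr_sqr y2; ring.
have h2 : 1 <= (y - x) * (3 * x).
  have -> : (y - x) * (3 * x) = (y - x) * (y + x) + (y - x) * (2 * x - y) by ring.
  by rewrite h lerDl mulr_ge0// subr_ge0// ltW.
have h3 : x * y <= 2 * x ^+ 2 by rewrite expr2; nra.
apply: (le_trans h3).
have -> : (y - x) * (6 * (x ^+ 2 * x)) = (2 * x ^+ 2) * ((y - x) * (3 * x)) by ring.
by rewrite ler_peMr// mulr_ge0// sqr_ge0.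
Qed.

Lemma chain_rate_telescope (l : nat) : (0 < l)%N ->
  1 + (Num.sqrt l.+1%:R)^-1 + chain_rate * (4 ^+ 3 / (l%:R * Num.sqrt l%:R) * 2)
  <= 1 + (Num.sqrt l%:R)^-1 :> R.
Proof.
move=> l0; have lp : 0 < l%:R :> R by rewrite ltr0n.
have := rsqrt_telescope l0.
rewrite (_ : chain_rate * _ = (6 * (l%:R * Num.sqrt l%:R))^-1); first lra.
rewrite /chain_rate; field.
by rewrite !gt_eqF ?sqrtr_gt0.
Qed.

Lemma close_indic u i j w :
  close u i j w = \1_[set w | forall k : 'I_3,
     cube ((W (mesh_time u j) w - W (mesh_time u i) w) ord0 k)] w.
Proof.
rewrite /close /close_incr; set v := W _ w - _.
have [h|] := pselect (forall k : 'I_3, cube (v ord0 k)).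
  rewrite indicE mem_set//=; apply: big1 => k _.
  by rewrite indicE mem_set.
move=> hn; rewrite indicE memNset//=.
have /existsNP[k hk] := hn.
by rewrite (bigD1 k)//= indicE memNset// mul0r.
Qed.

Lemma psi_expectation u n j last m (tt : nat -> R) (A : nat -> 'I_3 -> set R) :
  (last < j)%N -> tt 0%N = 0 -> (forall i, (i < m)%N -> tt i < tt i.+1) ->
  (forall i k, measurable (A i k)) -> tt m = mesh_time u last ->
  (\int[P]_w (\1_(incr_event m tt A) w * psi n j last u w)%:E <=
   P (incr_event m tt A) * (1 + (Num.sqrt (j - last)%:R)^-1)%:E)%E.
Proof.
elim: n j last m tt A => [|n ih] j last m tt A lj tt0 ttS mA ttm /=.
  under eq_integral do rewrite mulr1.
  rewrite integral_indic//; last exact: measurable_incr_event.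
  rewrite setIT -[leLHS]mule1 lee_wpmul2l// lee_fin lerDl invr_ge0.
  exact: sqrtr_ge0.
pose tt' i := if (i <= m)%N then tt i else mesh_time u j.
pose A' i k := if (i < m)%N then A i k else cube.
have mI : measurable (incr_event m tt A) by exact: measurable_incr_event.
have tt'0 : tt' 0%N = 0 by rewrite /tt' leq0n.
have lt_mesh : mesh_time u last < mesh_time u j.
  by rewrite ltrD2r ltr_pM2r ?exprn_gt0// ltr_nat.
have tt'S i : (i < m.+1)%N -> tt' i < tt' i.+1.
  rewrite ltnS leq_eqVlt => /predU1P[->|im].
    by rewrite /tt' leqnn ltnn ttm.
  by rewrite /tt' im (ltnW im); exact: ttS.
have mcube : measurable cube by exact: measurable_itv.
have mA' i k : measurable (A' i k) by rewrite /A'; case: ifP.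
have tt'm : tt' m.+1 = mesh_time u j by rewrite /tt' ltnn.
have P' : (P (incr_event m.+1 tt' A') <= P (incr_event m tt A) *
    (4 ^+ 3 / ((j - last)%:R * Num.sqrt (j - last)%:R))%:E)%E.
  rewrite /incr_event !fddW// big_ord_recr/=.
  rewrite [X in (X * _ <= _)%E](_ : _ =
      \prod_(i < m) \prod_(k < 3) normal_prob 0 (Num.sqrt (tt i.+1 - tt i)) (A i k))%E;
    last first.
    apply: eq_bigr => i _; apply: eq_bigr => k _.
    by rewrite /tt' /A' (ltn_ord i) (ltnW (ltn_ord i)).
  apply: lee_wpmul2l.
    by apply: prode_ge0 => i _; apply: prode_ge0 => k _.
  rewrite (_ : tt' m.+1 - tt' m = (j - last)%:R * rho ^+ 2); last first.
    rewrite tt'm /tt' leqnn ttm /mesh_time natrB ?(ltnW lj)//; ring.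
  under eq_bigr do rewrite /A' ltnn.
  by apply: normal_prob_cube_le; rewrite subn_gt0.
have E' w : \1_(incr_event m tt A) w * close u last j w =
    \1_(incr_event m.+1 tt' A') w :> R.
  rewrite close_indic -[LHS]/((\1_(incr_event m tt A) \* \1__) w) -indicI.
  congr (\1_ _ w); apply/seteqP; split => {}w /=.
    move=> [h1 h2] i k; rewrite ltnS leq_eqVlt => /predU1P[->|im].
      by rewrite /A' /tt' leqnn ltnn ttm.
    by rewrite /A' /tt' im (ltnW im); exact: h1.
  move=> h; split.
    move=> i k im; have := h i k (ltnW im).
    by rewrite /A' /tt' im (ltnW im).
  by move=> k; have := h m k (ltnSn _); rewrite /A' /tt' leqnn ltnn ttm.
have mpsi j' last' : measurable_fun setT (psi n j' last' u).
  exact: (measurable_section (f := fun u w => psi n j' last' u w) u (measurable_psi _ _ _)).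
have mind B : measurable B -> measurable_fun setT (\1_B : T -> R).
  by move=> mB; exact: measurable_indic.
have fE w : (\1_(incr_event m tt A) w * (psi n j.+1 last u w +
      chain_rate * (close u last j w * psi n j.+1 j u w)))%:E =
    ((\1_(incr_event m tt A) w * psi n j.+1 last u w)%:E +
     chain_rate%:E * (\1_(incr_event m.+1 tt' A') w * psi n j.+1 j u w)%:E)%E.
  by rewrite -E' -EFinM -EFinD; congr EFin; ring.
under eq_integral do rewrite fE.
have c0 := ltW chain_rate_gt0.
have mI' : measurable (incr_event m.+1 tt' A') by exact: measurable_incr_event.
have ge0 B j' l' w : (0 <= (\1_B w * psi n j' l' u w)%:E)%E.
  by rewrite lee_fin mulr_ge0 ?psi_ge0// indicE.
have mm B j' l' : measurable B ->
    measurable_fun setT (fun w => (\1_B w * psi n j' l' u w)%:E).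
  move=> mB; apply/measurable_EFinP; apply: measurable_funM; first exact: mind.
  exact: mpsi.
rewrite ge0_integralD//; last 3 first.
- exact: mm.
- by move=> w _; apply: mule_ge0; [rewrite lee_fin|exact: ge0].
- by apply: measurable_funeM; exact: mm.
rewrite ge0_integralZl//; last exact: mm.
have ih1 := ih j.+1 last m tt A (ltnW lj) tt0 ttS mA ttm.
have ih2 := ih j.+1 j m.+1 tt' A' (ltnSn _) tt'0 tt'S mA' tt'm.
apply: (le_trans (leeD ih1 (lee_wpmul2l _ ih2))); first by rewrite lee_fin.
rewrite subSnn sqrtr1 invr1 (subSn (ltnW lj)).
have Pf : P (incr_event m tt A) \is a fin_num by exact: fin_num_measure.
move: P'; rewrite -(fineK Pf); set p := fine _ => P'.
have p0 : 0 <= p by exact: fine_ge0.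
apply: (@le_trans _ _ (p%:E * (1 + (Num.sqrt (j - last).+1%:R)^-1)%:E +
    chain_rate%:E * (p%:E * (4 ^+ 3 / ((j - last)%:R * Num.sqrt (j - last)%:R))%:E
      * (1 + 1)%:E))%E).
  by apply: leeD2l; apply: lee_wpmul2l; rewrite ?lee_fin//; apply: lee_wpmul2r.
rewrite -!EFinM -EFinD lee_fin.
apply: le_trans (ler_wpM2l p0 (chain_rate_telescope (l := j - last) _)); last first.
  by rewrite subn_gt0.
by rewrite le_eqVlt; apply/orP; left; apply/eqP; ring.
Qed.

Lemma measurable_psi_section n j last u : measurable_fun setT (psi n j last u).
Proof.
exact: (measurable_section (f := fun u w => psi n j last u w) u (measurable_psi _ _ _)).
Qed.

Lemma psi_expectation_le2 u n i : 0 <= u ->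
  (\int[P]_w (psi n i.+1 i u w)%:E <= 2%:E)%E.
Proof.
move=> u0.
have m0 : 0 <= mesh_time u i by rewrite addr_ge0// mulr_ge0// sqr_ge0.
have key m tt : tt 0%N = 0 -> (forall k, (k < m)%N -> tt k < tt k.+1) ->
    tt m = mesh_time u i -> (\int[P]_w (psi n i.+1 i u w)%:E <= 2%:E)%E.
  move=> tt0 ttS ttm.
  have := @psi_expectation u n i.+1 i m tt (fun _ _ => setT) (ltnSn _) tt0 ttS
    (fun _ _ => measurableT) ttm.
  have -> : incr_event m tt (fun _ _ => setT) = setT.
    by apply/seteqP; split.
  rewrite probability_setT mul1e subSnn sqrtr1 invr1.
  by under eq_integral do rewrite indicT mul1r.
have [m00|mn0] := eqVneq (mesh_time u i) 0.
  by apply: (key 0%N (fun=> 0)).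
apply: (key 1%N (fun k => if k is 0%N then 0 else mesh_time u i)) => //.
by case=> // _; rewrite lt_neqAle eq_sym mn0.
Qed.

Lemma chain_sum_expectation u n i : 0 <= u ->
  (\int[P]_w (chain_sum n i u w)%:E <= (1 + 4 * n%:R)%:E)%E.
Proof.
move=> u0; have c0 := ltW chain_rate_gt0.
elim: n i => [|n ih] i /=.
  by rewrite mulr0 addr0 (integral_cst P measurableT 1%:E)
    [X in (_ * X)%E](probability_setT P) mule1.
under eq_integral do rewrite EFinD EFinM.
rewrite ge0_integralD//; last 4 first.
- by move=> w _; rewrite lee_fin chain_sum_ge0.
- apply/measurable_EFinP.
  exact: (measurable_section (f := fun u w => chain_sum n i.+1 u w) u (measurable_chain_sum _ _)).
- by move=> w _; rewrite mule_ge0// lee_fin ?psi_ge0// addr_ge0.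
- by apply: measurable_funeM; apply/measurable_EFinP; exact: measurable_psi_section.
rewrite ge0_integralZl//; last 3 first.
- by apply/measurable_EFinP; exact: measurable_psi_section.
- by move=> w _; rewrite lee_fin psi_ge0.
- by rewrite lee_fin addr_ge0.
apply: (le_trans (leeD (ih i.+1) (lee_wpmul2l _ (psi_expectation_le2 n i u0)))).
  by rewrite lee_fin addr_ge0.
rewrite -EFinM -EFinD lee_fin -natr1.
have : chain_rate <= 1 by rewrite invf_le1// mulr_ege1// ?exprn_ege1// ?ler1n.
lra.
Qed.

Section visits.
Variables (u : R) (w : T) (x : 'rV[R]_3) (v : nat -> bool).
Hypothesis hv : forall j, v j -> enorm3 (W (mesh_time u j) w - x) <= rho.

Lemma close_visits i j : v i -> v j -> close u i j w = 1.
Proof.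
move=> vi vj; rewrite /close /close_incr; apply: big1 => k _.
rewrite indicE mem_set// /cube /= in_itv/= -ler_norml.
have -> : W (mesh_time u j) w - W (mesh_time u i) w =
    (W (mesh_time u j) w - x) - (W (mesh_time u i) w - x).
  by rewrite opprB addrA subrK.
have nE (z : 'rV[R]_3) : `|(- z) ord0 k| = `|z ord0 k| by rewrite mxE normrN.
rewrite mxE; apply: (le_trans (ler_normD _ _)).
rewrite nE mulr_natl mulr2n.
by apply: lerD; apply: le_trans (coord_le_enorm3 _ _) _; exact: hv.
Qed.

Lemma psi_visits n j last : v last ->
  (1 + chain_rate) ^+ (\sum_(l < n) v (j + l)%N) <= psi n j last u w.
Proof.
have c0 := ltW chain_rate_gt0.
elim: n j last => [|n ih] j last vl; first by rewrite big_ord0 expr0.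
rewrite big_ord_recl addn0 /=.
under eq_bigr do rewrite /bump /= addnA addn1.
have [vj|nvj] := boolP (v j).
  rewrite close_visits// mul1r exprS mulrDl mul1r.
  by rewrite lerD ?ih// ler_wpM2l// ih.
rewrite add0n (le_trans (ih j.+1 last vl))// lerDl.
by rewrite mulr_ge0// mulr_ge0 ?psi_ge0// close_incr_ge0.
Qed.

Lemma chain_sum_visits n i :
  (1 + chain_rate) ^+ (\sum_(l < n) v (i + l)%N) <= chain_sum n i u w.
Proof.
have c0 := ltW chain_rate_gt0.
elim: n i => [|n ih] i; first by rewrite big_ord0 expr0.
rewrite big_ord_recl addn0 /=.
under eq_bigr do rewrite /bump /= addnA addn1.
have [vj|nvj] := boolP (v i).
  rewrite exprS; apply: ler_wpDl; first exact: chain_sum_ge0.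
  by rewrite ler_wpM2l ?psi_visits// addr_ge0.
rewrite add0n (le_trans (ih i.+1))// lerDl.
by rewrite mulr_ge0 ?psi_ge0// addr_ge0.
Qed.

End visits.

Definition level (m : nat) w :=
  (\int[uniform_prob (exprn_gt0 2 rho_gt0)]_u (chain_sum m 0 u w)%:E)%E.

Lemma measurable_chain_sum_swap m i :
  measurable_fun setT (fun p : T * R => (chain_sum m i p.2 p.1)%:E).
Proof.
apply/measurable_EFinP.
rewrite (_ : (fun p : T * R => _) = (fun p : R * T => chain_sum m i p.1 p.2) \o
  (fun p : T * R => (p.2, p.1)))//.
apply: measurableT_comp; first exact: measurable_chain_sum.
by apply/measurable_fun_pair; [exact: measurable_snd|exact: measurable_fst].
Qed.

Lemma measurable_level m : measurable_fun setT (level m).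
Proof.
apply: (@measurable_fun_fubini_tonelli_F _ _ T (measurableTypeR R) R
  (uniform_prob (exprn_gt0 2 rho_gt0)) (fun p => (chain_sum m 0 p.2 p.1)%:E)).
  exact: measurable_chain_sum_swap.
by move=> p; rewrite lee_fin chain_sum_ge0.
Qed.

Lemma level_ge0 m w : (0 <= level m w)%E.
Proof. by apply: integral_ge0 => u _; rewrite lee_fin chain_sum_ge0. Qed.

Lemma level_expectation m : (\int[P]_w level m w <= (1 + 4 * m%:R)%:E)%E.
Proof.
rewrite /level (@fubini_tonelli _ _ T (measurableTypeR R) R P (uniform_prob (exprn_gt0 2 rho_gt0))
  (fun p => (chain_sum m 0 p.2 p.1)%:E)); last 2 first.
- exact: measurable_chain_sum_swap.
- by move=> p; rewrite lee_fin chain_sum_ge0.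
have mG : measurable_fun setT
    ((fun u => \int[P]_w (chain_sum m 0 u w)%:E)%E : R -> \bar R).
  apply: (@measurable_fun_fubini_tonelli_G _ _ T (measurableTypeR R) R P
    (fun p => (chain_sum m 0 p.2 p.1)%:E)).
    exact: measurable_chain_sum_swap.
  by move=> p; rewrite lee_fin chain_sum_ge0.
rewrite integral_uniform//; last first.
  by move=> u; apply: integral_ge0 => w _; rewrite lee_fin chain_sum_ge0.
have h0 : 0 < rho ^+ 2 by rewrite exprn_gt0.
apply: (@le_trans _ _ ((rho ^+ 2 - 0)^-1%:E *
   \int[lebesgue_measure]_(u in `[0%R, (rho ^+ 2)%R]) (cst (1 + 4 * m%:R)%:E u))%E).
  apply: lee_wpmul2l; first by rewrite lee_fin invr_ge0 subr0 ltW.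
  apply: ge0_le_integral => //.
  - by move=> u _; apply: integral_ge0 => w _; rewrite lee_fin chain_sum_ge0.
  - exact: measurable_funTS.
  - move=> u /=; rewrite in_itv/= => /andP[u0 _]; exact: chain_sum_expectation.
rewrite integral_cst//= lebesgue_measure_itv/= lte_fin h0 -EFinD -!EFinM lee_fin.
by rewrite mulrCA mulVf ?mulr1// subr0 gt_eqF.
Qed.

Lemma level_tail m (A : R) :
  (P [set w | ((expR A)%:E < level m w)%E] <= ((1 + 4 * m%:R) * expR (- A))%:E)%E.
Proof.
have mS : measurable [set w | ((expR A)%:E < level m w)%E].
  rewrite -[X in measurable X]setTI; apply: emeasurable_fun_o_infty => //.
  exact: measurable_level.
have h : ((expR A)%:E * P [set w | ((expR A)%:E < level m w)%E] <=
    (1 + 4 * m%:R)%:E)%E.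
  apply: le_trans (level_expectation m).
  rewrite -[X in P X]setIT -integral_indic// -ge0_integralZl ?lee_fin ?expR_ge0//; last first.
    exact/measurable_EFinP/measurable_indic.
  apply: ge0_le_integral => //.
  - by apply: measurable_funeM; apply/measurable_EFinP; exact: measurable_indic.
  - exact: measurable_level.
  - move=> w _; rewrite indicE; case: (boolP (w \in _)) => [/set_mem/= /ltW hw|_].
      by rewrite mule1.
    by rewrite mule0 level_ge0.
have Pf : P [set w | ((expR A)%:E < level m w)%E] \is a fin_num.
  exact: fin_num_measure.
move: h; rewrite -(fineK Pf) -EFinM !lee_fin => h.
by rewrite expRN ler_pdivlMr ?expR_gt0// mulrC.
Qed.

Lemma lebesgue_integral_shift (F : R -> \bar R) (a h : R) :
  measurable_fun setT F -> (forall s, 0 <= F s)%E ->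
  (\int[lebesgue_measure]_(s in `[a, (a + h)%R]) F s =
   \int[lebesgue_measure]_(u in `[0%R, h]) F (a + u)%R)%E.
Proof.
move=> mF F0.
have mphi : measurable_fun setT ((fun u => a + u) : measurableTypeR R -> measurableTypeR R).
  by apply: measurable_funD => //; exact: measurable_cst.
rewrite (_ : `[0%R, h]%classic =
    ((fun u => a + u) : measurableTypeR R -> measurableTypeR R) @^-1` `[a, (a + h)]); last first.
  by apply/seteqP; split => u /=; rewrite !in_itv/= lerDl lerD2l.
rewrite -(@ge0_integral_pushforward _ _ _ _ R _ mphi lebesgue_measure)//; last first.
  exact: measurable_funTS.
apply: eq_measure_integral => A mA _.
apply: lebesgue_measure_unique => //= _ [[x y]] _ <-.
rewrite /pushforward/=.
rewrite (_ : (fun u => a + u) @^-1` `]x, y] = `](x - a), (y - a)]%classic); last first.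
  by apply/seteqP; split => u /=; rewrite !in_itv/= ltrBlDl lerBrDl.
rewrite !lebesgue_measure_itv/= !lte_fin ltrD2r -!EFinD.
by case: ifP => // _; congr EFin; ring.
Qed.

Lemma mesh_integral_le (F : R -> \bar R) (h : R) m : 0 <= h ->
  measurable_fun setT F -> (forall s, 0 <= F s)%E ->
  (\int[lebesgue_measure]_(s in `[0%R, (m%:R * h)%R]) F s <=
   \sum_(j < m) \int[lebesgue_measure]_(u in `[0%R, h]) F (j%:R * h + u)%R)%E.
Proof.
move=> h0 mF F0; elim: m => [|m ih].
  by rewrite mul0r set_itv1 integral_set1 big_ord0.
have mh : 0 <= m%:R * h by rewrite mulr_ge0.
have hle : m%:R * h <= m.+1%:R * h by rewrite ler_wpM2r// ler_nat.
rewrite big_ord_recr/= (@itv_bndbnd_setU _ _ _ (BRight (m%:R * h))); last 2 first.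
- by rewrite bnd_simp.
- by rewrite bnd_simp.
rewrite ge0_integral_setU//=; last 2 first.
- exact: measurable_funTS.
- apply/disj_setPS => s [/=]; rewrite !in_itv/= => /andP[_ s1] /andP[s2 _].
  by move: s1; rewrite leNgt s2.
apply: leeD => //.
rewrite -lebesgue_integral_shift// (_ : m%:R * h + h = m.+1%:R * h); last first.
  by rewrite -natr1 mulrDl mul1r.
apply: ge0_subset_integral => //=; first exact: measurable_funTS.
by apply: subset_itvr; rewrite bnd_simp.
Qed.

Lemma occupation_le (w : T) (x : 'rV[R]_3) m (A : R) : 0 <= A ->
  (level m w <= (expR A)%:E)%E ->
  (\int[lebesgue_measure]_(s in `[0%R, (m%:R * rho ^+ 2)%R])
     ((enorm3 (W s w - x) <= rho)%R%:R)%:E <=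
   (rho ^+ 2 * (A / ln (1 + chain_rate)))%:E)%E.
Proof.
move=> A0 lA; have c0 := chain_rate_gt0.
have h0 : 0 < rho ^+ 2 by rewrite exprn_gt0.
set c := ln _; have cp : 0 < c by rewrite ln_gt0// ltrDl.
pose v u j := enorm3 (W (mesh_time u j) w - x) <= rho.
have mWs k : measurable_fun setT (fun s => W s w ord0 k).
  rewrite (_ : (fun s => _) = (fun p : R * T => W p.1 p.2 ord0 k) \o (fun s => (s, w)))//.
  by apply: measurableT_comp => //; exact: measurable_pair2.
have mN : measurable_fun setT (fun s => enorm3 (W s w - x)).
  by apply: measurable_enorm3 => k; under eq_fun do rewrite !mxE; exact: measurable_funB.
have mF : measurable_fun setT (fun s => ((enorm3 (W s w - x) <= rho)%R%:R : R)%:E).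
  exact: measurable_le_indic.
have F0 s : (0 <= ((enorm3 (W s w - x) <= rho)%R%:R : R)%:E)%E by rewrite lee_fin.
apply: (le_trans (mesh_integral_le m (ltW h0) mF F0)).
have mshift j : measurable_fun setT
    (fun u => ((enorm3 (W (j%:R * rho ^+ 2 + u) w - x) <= rho)%R%:R : R)%:E).
  rewrite (_ : (fun u => _) = (fun s => ((enorm3 (W s w - x) <= rho)%R%:R : R)%:E) \o
    (fun u => j%:R * rho ^+ 2 + u))//.
  by apply: measurableT_comp => //; apply: measurable_funD.
rewrite [leLHS](_ : _ = (\int[lebesgue_measure]_(u in `[0%R, (rho ^+ 2)%R])
    (\sum_(j < m) ((enorm3 (W (j%:R * rho ^+ 2 + u) w - x) <= rho)%R%:R)%:E))%E);
  last first.
  by rewrite ge0_integral_sum// => j; exact: measurable_funTS (mshift j).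
pose N u := (\sum_(j < m) v u (0 + j)%N)%N.
under eq_integral => u _ do rewrite sumEFin -natr_sum -[X in X%:R%:E]/(N u).
have mNu : measurable_fun setT (fun u => ((N u)%:R : R)%:E).
  rewrite (_ : (fun u => _) = fun u => (\sum_(j < m)
    ((enorm3 (W (j%:R * rho ^+ 2 + u) w - x) <= rho)%R%:R : R)%:E)%E).
    exact: emeasurable_sum.
  by apply/funext => u; rewrite sumEFin -natr_sum.
pose U := uniform_prob (exprn_gt0 2 rho_gt0).
have -> : (\int[lebesgue_measure]_(u in `[0%R, (rho ^+ 2)%R]) ((N u)%:R)%:E =
    (rho ^+ 2)%:E * \int[U]_u ((N u)%:R)%:E)%E.
  rewrite integral_uniform//.
  by rewrite muleA -EFinM subr0 divff ?mul1e// gt_eqF.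
rewrite [leRHS]EFinM; apply: lee_wpmul2l; first by rewrite lee_fin ltW.
have mG : measurable_fun setT (fun u => (chain_sum m 0 u w)%:E).
  rewrite (_ : (fun u => _) = (fun p : T * R => (chain_sum m 0 p.2 p.1)%:E) \o
    (fun u => (w, u)))//.
  apply: measurableT_comp; first exact: measurable_chain_sum_swap.
  exact: measurable_pair1.
(* tangent line of [expR] at [A] *)
have pt u : (c%:E * ((N u)%:R)%:E + 1 <=
    (expR (- A))%:E * (chain_sum m 0 u w)%:E + A%:E)%E.
  rewrite -!EFinM -!EFinD lee_fin.
  have h1 : (1 + chain_rate) ^+ N u <= chain_sum m 0 u w.
    by apply: (@chain_sum_visits u w x (v u)).
  have h2 : expR (c * (N u)%:R) = (1 + chain_rate) ^+ N u.
    by rewrite mulrC expRM_natl lnK// posrE addr_gt0.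
  have h3 := expR_ge1Dx (c * (N u)%:R - A).
  have h4 : expR (c * (N u)%:R - A) <= expR (- A) * chain_sum m 0 u w.
    by rewrite expRD h2 mulrC ler_wpM2l ?expR_ge0.
  by move: (le_trans h3 h4); rewrite addrA lerBlDr addrC.
have fin : (\int[U]_u ((N u)%:R)%:E)%E \is a fin_num.
  rewrite ge0_fin_numE; last by apply: integral_ge0 => u _; rewrite lee_fin.
  apply: (@le_lt_trans _ _ (m%:R)%:E); last exact: ltry.
  apply: probability_integral_le => // u; rewrite lee_fin ler_nat.
  rewrite -[leqRHS]card_ord -sum1_card; apply: leq_sum => i _.
  by case: (v _ _).
have key : (c%:E * \int[U]_u ((N u)%:R)%:E + 1 <= (1 + A)%:E)%E.
  rewrite -ge0_integralZl//; last by rewrite lee_fin ltW.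
  rewrite -probability_integralDc//; last 2 first.
    exact: measurable_funeM.
    by move=> u; rewrite mule_ge0 ?lee_fin// ltW.
  apply: (@le_trans _ _ (\int[U]_u
      ((expR (- A))%:E * (chain_sum m 0 u w)%:E + A%:E))%E).
    apply: ge0_le_integral => //.
    - by move=> u _; rewrite adde_ge0 ?mule_ge0 ?lee_fin// ltW.
    - by apply: emeasurable_funD => //; exact: measurable_funeM.
    - by apply: emeasurable_funD => //; exact: measurable_funeM.
  rewrite probability_integralDc//; [|exact: measurable_funeM|]; last first.
    by move=> u; rewrite mule_ge0 ?lee_fin ?expR_ge0 ?chain_sum_ge0.
  rewrite ge0_integralZl ?lee_fin ?expR_ge0//; last first.
    by move=> u _; rewrite lee_fin chain_sum_ge0.
  rewrite EFinD; apply: leeD2r.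
  apply: (@le_trans _ _ ((expR (- A))%:E * (expR A)%:E)%E).
    by apply: lee_wpmul2l; [rewrite lee_fin expR_ge0|exact: lA].
  by rewrite -EFinM -expRD addNr expR0.
move: key; rewrite -(fineK fin) -EFinM -EFinD !lee_fin => key.
by rewrite ler_pdivlMr// mulrC; move: key; rewrite addrC lerD2l.
Qed.

End chains.

(** * Smoothing over squares *)
Section square_smoothing.
Context {R : realType}.
Let X := measurableTypeR R.

Definition unit_square_prob : probability (X * X)%type R :=
  (uniform_prob (@ltr01 R) \x uniform_prob (@ltr01 R))%E.

Definition clip01 (a : R) : R := Num.min (Num.max a 0) 1.

Definition square_shift (z : X * X) : 'rV[R]_3 :=
  \row_k (if k == 0 then clip01 z.1 / 2
          else if k == 1 then clip01 z.2 / 2 else 0).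

Lemma clip01_itv a : 0 <= clip01 a <= 1.
Proof. by rewrite le_min le_max lexx orbT ler01 ge_min lexx orbT. Qed.

Lemma clip01_id a : 0 <= a <= 1 -> clip01 a = a.
Proof. by move=> /andP[a0 a1]; rewrite /clip01 max_l// min_l. Qed.

Lemma measurable_clip01 : measurable_fun setT (clip01 : X -> R).
Proof.
apply: measurable_minr; last exact: measurable_cst.
by apply: measurable_maxr; [exact: measurable_id|exact: measurable_cst].
Qed.

Lemma measurable_square_shift k :
  measurable_fun setT (fun z => square_shift z ord0 k).
Proof.
under eq_fun do rewrite mxE.
case: (k == 0).
  apply: measurable_funM; last exact: measurable_cst.
  exact: measurableT_comp measurable_clip01 measurable_fst.
case: (k == 1); last exact: measurable_cst.
apply: measurable_funM; last exact: measurable_cst.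
exact: measurableT_comp measurable_clip01 measurable_snd.
Qed.

Lemma square_shift_le1 z : enorm3 (square_shift z) <= 1.
Proof.
rewrite [leRHS](_ : 1 = 2 * 2^-1); last by rewrite divff.
apply: enorm3_le_coord => k; rewrite mxE.
have h (a : R) : `|clip01 a / 2| <= 2^-1.
  have /andP[h1 h2] := clip01_itv a.
  by rewrite ger0_norm ?divr_ge0// ler_pdivrMr// mulVf.
by case: ifP => _ //; case: ifP => _ //; rewrite normr0.
Qed.

Lemma measurable_clip_strip (y rho : R) :
  measurable [set a : X | `|y + clip01 a / 2| <= rho].
Proof.
apply: measurable_le_set; apply: measurableT_comp => //.
apply: measurable_funD; first exact: measurable_cst.
by apply: measurable_funM; [exact: measurable_clip01|exact: measurable_cst].
Qed.

Lemma uniform_clip_strip (y rho : R) : 0 < rho ->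
  (uniform_prob (@ltr01 R) [set a : X | (`|y + clip01 a / 2| <= rho)%R] <=
   (4 * rho)%:E)%E.
Proof.
move=> rho0; have mS := measurable_clip_strip y rho.
rewrite /uniform_prob integral_uniform_pdf.
set J := (`[2 * (- rho - y), 2 * (rho - y)]%classic : set X).
apply: (@le_trans _ _ (\int[lebesgue_measure]_(x in J) (cst 1%:E x))%E); last first.
  rewrite integral_cst; last exact: measurable_itv.
  rewrite /= /J lebesgue_measure_itv/= lte_fin mul1e.
  by case: ifP => _; rewrite -?EFinD lee_fin; lra.
apply: (@le_trans _ _ (\int[lebesgue_measure]_(x in
    [set a : X | (`|y + clip01 a / 2| <= rho)%R] `&` `[0%R, 1%R]) (cst 1%:E x))%E).
  apply: ge0_le_integral => //.
  - exact: measurableI.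
  - by move=> a _; rewrite lee_fin uniform_pdf_ge0.
  - by apply/measurable_EFinP/measurable_funTS; exact: measurable_uniform_pdf.
  - move=> a _; rewrite lee_fin /uniform_pdf subr0 invr1.
    by case: ifP.
apply: ge0_subset_integral => //; [exact: measurableI|exact: measurable_itv|].
move=> a [/= h]; rewrite in_itv/= => a01; move: h.
rewrite /J/= in_itv/= clip01_id// ler_norml => /andP[h1 h2].
by apply/andP; split; lra.
Qed.

Lemma square_shift_ball (y : 'rV[R]_3) (rho : R) : 0 < rho ->
  (unit_square_prob [set z | (enorm3 (y + square_shift z) <= rho)%R] <=
   (16 * rho ^+ 2)%:E)%E.
Proof.
move=> rho0.
have mE : measurable [set z | enorm3 (y + square_shift z) <= rho].
  apply: measurable_le_set; apply: measurable_enorm3 => k.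
  under eq_fun do rewrite mxE.
  by apply: measurable_funD; [exact: measurable_cst|exact: measurable_square_shift].
pose S k := [set a : X | `|y ord0 k + clip01 a / 2| <= rho].
have mS k : measurable (S k) by exact: measurable_clip_strip.
apply: (@le_trans _ _ (unit_square_prob (S 0 `*` S 1))).
  apply: le_measure; rewrite ?inE//; first exact: measurableX.
  move=> z /= hz; split => /=.
    by have := le_trans (coord_le_enorm3 _ 0) hz; rewrite !mxE eqxx.
  by have := le_trans (coord_le_enorm3 _ 1) hz; rewrite !mxE.
have -> : (unit_square_prob (S 0%R `*` S 1%R) =
    uniform_prob (@ltr01 R) (S 0%R) * uniform_prob (@ltr01 R) (S 1%R))%E.
  exact: product_measure1E.
have -> : (16 * rho ^+ 2)%:E = ((4 * rho)%:E * (4 * rho)%:E)%E.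
  by rewrite -EFinM; congr EFin; ring.
by apply: lee_pmul => //; exact: uniform_clip_strip.
Qed.

End square_smoothing.

(** * Oscillation of the Brownian potential *)
Section brownian_potential.
Context {R : realType} {d : measure_display} {T : measurableType d}.
Variables (P : probability T R) (W : R -> T -> 'rV[R]_3).
Hypothesis mW : forall k, measurable_fun setT (fun p : R * T => W p.1 p.2 ord0 k).
Hypothesis fddW : forall (n : nat) (tt : nat -> R) (A : nat -> 'I_3 -> set R),
  tt 0%N = 0 ->
  (forall i, (i < n)%N -> tt i < tt i.+1) ->
  (forall i k, measurable (A i k)) ->
  P [set w | forall i (k : 'I_3), (i < n)%N ->
               A i k ((W (tt i.+1) w - W (tt i) w) ord0 k)] =
  (\prod_(i < n) \prod_(k < 3)
      normal_prob 0 (Num.sqrt (tt i.+1 - tt i)) (A i k))%E.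
Variables (t b : R).
Hypotheses (t_gt0 : 0 < t) (b_gt0 : 0 < b).

Let U : probability (measurableTypeR R) R := uniform_prob t_gt0.

Lemma Lambda_pot w x : Lambda W t w x = pot U W w x.
Proof.
have mF : measurable_fun setT ((fun s => coulomb (enorm3 (W s w - x))) : R -> \bar R).
  exact: (@measurable_coulomb_path _ _ _ (measurableTypeR R) T W mW w x).
rewrite /pot /U integral_uniform//; last by move=> s; exact: coulomb_enorm3_ge0.
rewrite /Lambda subr0; congr (_ * _)%E.
rewrite (_ : [set s | _] = `[0%R, t]%classic); last first.
  by apply/seteqP; split => s /=; rewrite in_itv.
by apply: eq_integral => s _; rewrite /coulomb enorm3_eq0 subr_eq0.
Qed.

Lemma modulus_event_osc delta :
  modulus_event W t delta b = [set w | (b%:E <= osc U W w delta)%E].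
Proof.
rewrite /modulus_event (_ : Lambda W t = pot U W)//.
by apply/funext => w; apply/funext => x; exact: Lambda_pot.
Qed.

Lemma measurable_modulus_event delta : 0 < delta ->
  measurable (modulus_event W t delta b).
Proof.
move=> d0; rewrite modulus_event_osc.
by apply: (@measurable_osc _ _ _ _ _ _ _ U unit_square_prob W square_shift 16) => //;
  [exact: measurable_square_shift|exact: square_shift_le1|exact: square_shift_ball].
Qed.

Definition mesh_count k := (Num.truncn (t * 16 ^+ k)).+1.

Definition decay : R := ln (1 + @chain_rate R) * (b / 32).

Definition bad_scale k :=
  [set w | ((expR (decay * t * 2 ^+ k))%:E <
            level W (scale4_gt0 k) (mesh_count k) w)%E].

Lemma decay_gt0 : 0 < decay.
Proof. by rewrite mulr_gt0 ?divr_gt0// ln_gt0// ltrDl chain_rate_gt0. Qed.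

Let measurable_dist w x : measurable_fun setT (fun s => enorm3 (W s w - x)).
Proof.
apply: measurable_enorm3 => j; under eq_fun do rewrite !mxE.
apply: measurable_funD => //.
rewrite (_ : (fun s => _) = (fun p : R * T => W p.1 p.2 ord0 j) \o (fun s => (s, w)))//.
by apply: measurableT_comp => //; exact: measurable_pair2.
Qed.

Lemma layer_integral_le k w x : ~ bad_scale k w ->
  (\int[U]_s (layer k (enorm3 (W s w - x)))%:E <= (b / 8 * 2^-1 ^+ k)%:E)%E.
Proof.
move=> /negP; rewrite -leNgt => hk.
have e0 : 0 <= decay * t * 2 ^+ k.
  by rewrite mulr_ge0 ?exprn_ge0// mulr_ge0 ?ltW ?decay_gt0.
have occ := occupation_le mW x e0 hk.
have ml : measurable_fun setT (fun s => (layer k (enorm3 (W s w - x)))%:E).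
  by apply: measurable_layer; exact: measurable_dist.
have l0 s : (0 <= (layer k (enorm3 (W s w - x)))%:E)%E by rewrite lee_fin layer_ge0.
rewrite /U integral_uniform// subr0.
have tm : t <= (mesh_count k)%:R * scale4 k ^+ 2.
  rewrite (_ : scale4 k ^+ 2 = (16 ^+ k)^-1); last first.
    rewrite /scale4 -exprM mulnC exprM -exprVn; congr (_ ^+ _).
    by rewrite expr2 -invfM -natrM.
  by rewrite ler_pdivlMr ?exprn_gt0// ltW// truncnS_gt.
apply: (@le_trans _ _ (t^-1%:E * (4 ^+ k.+1 *
   (scale4 k ^+ 2 * (decay * t * 2 ^+ k / ln (1 + chain_rate))))%:E)%E).
  apply: lee_wpmul2l; first by rewrite lee_fin invr_ge0 ltW.
  apply: (@le_trans _ _ (\int[lebesgue_measure]_(s in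
      `[0%R, ((mesh_count k)%:R * scale4 k ^+ 2)%R]) (layer k (enorm3 (W s w - x)))%:E)%E).
    apply: ge0_subset_integral => //; first exact: measurable_funTS.
    by apply: subset_itvl; rewrite bnd_simp.
  under eq_integral do rewrite /layer EFinM.
  rewrite ge0_integralZl ?lee_fin ?exprn_ge0//; last first.
    by apply/measurable_funTS/measurable_le_indic; exact: measurable_dist.
  rewrite [leRHS]EFinM; apply: lee_wpmul2l; first by rewrite lee_fin exprn_ge0.
  exact: occ.
rewrite -EFinM lee_fin le_eqVlt; apply/orP; left; apply/eqP.
have cp : ln (1 + chain_rate) != 0 :> R.
  by rewrite gt_eqF// ln_gt0// ltrDl chain_rate_gt0.
have -> : scale4 k = (2 ^+ k)^-1 * (2 ^+ k)^-1 :> R.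
  by rewrite -exprVn -exprMn /scale4; congr (_ ^+ _); rewrite -invfM -natrM.
have -> : 4 ^+ k.+1 = 4 * (2 ^+ k * 2 ^+ k) :> R.
  by rewrite exprS -exprMn -natrM.
rewrite /decay exprVn; field.
by rewrite expf_neq0//= cp gt_eqF.
Qed.

Definition truncated_pot k0 w x :=
  (\int[U]_s ((Num.max (enorm3 (W s w - x)) (scale4 k0))^-1)%:E)%E.

Let measurable_truncated k0 w x : measurable_fun setT
  ((fun s => ((Num.max (enorm3 (W s w - x)) (scale4 k0))^-1)%:E) : R -> \bar R).
Proof.
apply/measurable_EFinP; apply: measurable_maxV; first exact: scale4_gt0.
exact: measurable_dist.
Qed.

Let truncated_ge0 k0 w x s :
  (0 <= ((Num.max (enorm3 (W s w - x)) (scale4 k0))^-1)%:E)%E.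
Proof. by rewrite lee_fin invr_ge0 le_max enorm3_ge0. Qed.

Let measurable_coul w x : measurable_fun setT
  ((fun s => coulomb (enorm3 (W s w - x))) : R -> \bar R).
Proof. by apply: measurable_coulomb => // s; exact: enorm3_ge0. Qed.

Lemma pot_le_truncated k0 w x : (forall k, ~ bad_scale (k0 + k) w) ->
  (pot U W w x <= truncated_pot k0 w x + (b / 4)%:E)%E.
Proof.
move=> good.
have ml k : measurable_fun (setT : set (measurableTypeR R))
    (fun s => (layer k (enorm3 (W s w - x)))%:E).
  by apply: measurable_layer; exact: measurable_dist.
have l0 k s : (0 <= (layer k (enorm3 (W s w - x)))%:E)%E by rewrite lee_fin layer_ge0.
apply: (@le_trans _ _ (\int[U]_s (((Num.max (enorm3 (W s w - x)) (scale4 k0))^-1)%:E +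
    \sum_(k <oo) (layer (k0 + k) (enorm3 (W s w - x)))%:E))%E).
  apply: ge0_le_integral => //.
  - by move=> s _; exact: coulomb_enorm3_ge0.
  - exact: measurable_coul.
  - by apply: emeasurable_funD; [exact: measurable_truncated|exact: ge0_emeasurable_sum].
  - by move=> s _; exact/coulomb_le_layers/enorm3_ge0.
rewrite ge0_integralD//; last 3 first.
- exact: measurable_truncated.
- by move=> s _; exact: nneseries_ge0.
- exact: ge0_emeasurable_sum.
apply: leeD2l; rewrite integral_nneseries//.
apply: nneseries_le => [i|j]; first exact: integral_ge0.
apply: (@le_trans _ _ (\sum_(i < j) (b / 8 * 2^-1 ^+ (k0 + i))%:E)%E).
  by apply: lee_sum => i _; exact: layer_integral_le.
rewrite sumEFin lee_fin -mulr_sumr.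
apply: (@le_trans _ _ (b / 8 * 2)); last by have := b_gt0; lra.
rewrite ler_wpM2l ?divr_ge0 ?ltW//.
suff h : \sum_(i < j) 2^-1 ^+ (k0 + i) <= 2 * (1 - 2^-1 ^+ j) :> R.
  have q0 : 0 < 2^-1 ^+ j :> R by rewrite exprn_gt0.
  lra.
elim: j => [|j ih]; first by rewrite big_ord0 expr0 subrr mulr0.
rewrite big_ord_recr/=.
have h : 2^-1 ^+ (k0 + j) <= 2^-1 ^+ j :> R.
  by rewrite ler_wiXn2l ?invf_le1 ?ler1n// leq_addl.
by rewrite exprS; lra.
Qed.

Lemma truncated_le_pot k0 w x : (truncated_pot k0 w x <= pot U W w x)%E.
Proof.
rewrite /truncated_pot /pot; apply: ge0_le_integral.
- exact: measurableT.
- by move=> s _; exact: truncated_ge0.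
- exact: measurable_truncated.
- exact: measurable_coul.
by move=> s _; apply: maxV_le_coulomb; [exact: enorm3_ge0|exact: scale4_gt0].
Qed.

Lemma truncated_pot_fin k0 w x : truncated_pot k0 w x \is a fin_num.
Proof.
rewrite ge0_fin_numE; last exact: integral_ge0.
apply: (@le_lt_trans _ _ (4 ^+ k0)%:E); last exact: ltry.
apply: probability_integral_le; [exact: measurable_truncated|exact: truncated_ge0|].
move=> s; rewrite lee_fin -scale4V lef_pV2 ?posrE ?scale4_gt0//.
  by rewrite le_max lexx orbT.
by rewrite lt_max scale4_gt0 orbT.
Qed.

Lemma truncated_pot_lip k0 w x1 x2 delta : enorm3 (x1 - x2) <= delta ->
  delta <= b / 4 * scale4 k0 ^+ 2 ->
  (truncated_pot k0 w x1 <= truncated_pot k0 w x2 + (b / 4)%:E)%E.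
Proof.
move=> x12 hd; have sp := @scale4_gt0 R k0.
have b4 : (0 <= (b / 4)%:E :> \bar R)%E by rewrite lee_fin divr_ge0// ltW.
rewrite /truncated_pot -probability_integralDc//; last exact: measurable_truncated.
apply: ge0_le_integral.
- exact: measurableT.
- by move=> s _; exact: truncated_ge0.
- exact: measurable_truncated.
- exact: emeasurable_funD (measurable_truncated _ _ _) (measurable_cst _).
move=> s _; rewrite -EFinD lee_fin.
apply: (le_trans (maxV_lip _ (enorm3 (W s w - x2)) sp)).
rewrite lerD2l ler_pdivrMr ?exprn_gt0//; apply: le_trans hd; apply: le_trans x12.
apply: (le_trans (ler_enorm3_dist _ _)).
have -> : W s w - x1 - (W s w - x2) = x2 - x1.
  by rewrite opprB addrC addrA subrK.
by rewrite enorm3_distC.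
Qed.

Lemma modulus_event_bad k0 delta : delta <= b / 4 * scale4 k0 ^+ 2 ->
  modulus_event W t delta b `<=` \bigcup_k bad_scale (k0 + k).
Proof.
move=> hd w; rewrite modulus_event_osc /= => hw; apply: contrapT => hn.
have good k : ~ bad_scale (k0 + k) w by move=> hk; apply: hn; exists k.
have b4 : b / 4 + b / 4 < b by have := b_gt0; lra.
suff : (osc U W w delta <= (b / 4 + b / 4)%:E)%E.
  by move=> /(le_trans hw); rewrite lee_fin leNgt b4.
have pf x : pot U W w x \is a fin_num.
  rewrite ge0_fin_numE; last first.
    by apply: integral_ge0 => s _; exact: coulomb_enorm3_ge0.
  apply: (le_lt_trans (pot_le_truncated x good)).
  by rewrite lte_add_pinfty// ?ltry// ltey_eq truncated_pot_fin.
have key x1 x2 : enorm3 (x1 - x2) <= delta ->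
    (pot U W w x1 <= pot U W w x2 + (b / 4 + b / 4)%:E)%E.
  move=> x12; apply: (le_trans (pot_le_truncated x1 good)).
  rewrite EFinD addeA; apply: leeD2r.
  apply: (le_trans (truncated_pot_lip w x12 hd)); apply: leeD2r.
  exact: truncated_le_pot.
apply: ge_ereal_sup => _ [[x1 x2] /= x12 <-].
by apply: lee_dist => //; apply: key => //; rewrite enorm3_distC.
Qed.

Lemma measurable_bad_scale k : measurable (bad_scale k).
Proof.
rewrite -[X in measurable X]setTI; apply: emeasurable_fun_o_infty => //.
exact: measurable_level.
Qed.

Definition tail_cst : R := 9 * (10 / decay) ^+ 5.

Lemma tail_cst_gt0 : 0 < tail_cst.
Proof. by rewrite mulr_gt0// exprn_gt0// divr_gt0// decay_gt0. Qed.

Lemma expR_ge_pow5 (y : R) : 0 <= y -> (y / 5) ^+ 5 <= expR y.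
Proof.
move=> y0; have -> : expR y = expR (y / 5) ^+ 5.
  by rewrite -expRM_natl mulrC divfK.
rewrite ler_pXn2r// ?nnegrE ?expR_ge0 ?divr_ge0//.
by apply: le_trans (expR_ge1Dx _); lra.
Qed.

Lemma bad_scale_le k : 1 <= t ->
  (P (bad_scale k) <=
   (tail_cst * 2^-1 ^+ k * expR (- (decay * t * 2 ^+ k / 2)))%:E)%E.
Proof.
move=> t1; apply: (le_trans (level_tail mW fddW _ _ _)); rewrite lee_fin.
have t0 := ltW t_gt0; set z := t * 2 ^+ k; have kp := decay_gt0.
have k2 : 1 <= 2 ^+ k :> R by rewrite exprn_ege1// ler1n.
have z1 : 2 ^+ k <= z by rewrite ler_peMl// exprn_ge0.
have z0 : 0 < z by rewrite (lt_le_trans _ z1)// (lt_le_trans ltr01).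
have mc : 1 + 4 * (mesh_count k)%:R <= 9 * z ^+ 4.
  have h : (mesh_count k)%:R <= t * 16 ^+ k + 1.
    rewrite /mesh_count -natr1 lerD2r truncn_le mulr_ge0// ?exprn_ge0//.
  have -> : z ^+ 4 = t ^+ 4 * 16 ^+ k.
    by rewrite /z exprMn -exprM mulnC exprM; congr (_ * _ ^+ _); rewrite -natrX.
  have t4 : t <= t ^+ 4 by rewrite -[leLHS]expr1 ler_weXn2l.
  have e1 : 1 <= 16 ^+ k :> R by rewrite exprn_ege1// ler1n.
  have te : t * 16 ^+ k <= t ^+ 4 * 16 ^+ k.
    by rewrite ler_wpM2r// exprn_ge0.
  have t1e : 1 <= t * 16 ^+ k by rewrite mulr_ege1.
  lra.
have -> : decay * t * 2 ^+ k = decay * z by rewrite mulrA.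
set y := decay * z / 2.
have y0 : 0 < y by rewrite divr_gt0// mulr_gt0.
have -> : expR (- (decay * z)) = expR (- y) * expR (- y).
  by rewrite -expRD; congr expR; rewrite /y; field.
rewrite mulrA ler_wpM2r ?expR_ge0//.
apply: (le_trans (ler_wpM2r (expR_ge0 _) mc)).
have py := expR_ge_pow5 (ltW y0).
have py0 : 0 < (y / 5) ^+ 5 by rewrite exprn_gt0// divr_gt0.
apply: (@le_trans _ _ (9 * z ^+ 4 * ((y / 5) ^+ 5)^-1)).
  rewrite ler_wpM2l ?mulr_ge0 ?exprn_ge0// ?(ltW z0)//.
  by rewrite expRN lef_pV2 ?posrE ?expR_gt0.
have -> : 9 * z ^+ 4 * ((y / 5) ^+ 5)^-1 = tail_cst * z^-1.
  by rewrite /tail_cst /y; field; rewrite !gt_eqF.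
rewrite ler_wpM2l ?(ltW tail_cst_gt0)// exprVn lef_pV2 ?posrE//.
Qed.

Lemma modulus_event_prob k0 delta : 1 <= t -> 0 < delta ->
  delta <= b / 4 * scale4 k0 ^+ 2 ->
  (P (modulus_event W t delta b) <=
   (2 * tail_cst * expR (- (decay * t * 2 ^+ k0 / 2)))%:E)%E.
Proof.
move=> t1 d0 hd; have kp := decay_gt0; have cp := tail_cst_gt0.
set E := expR _.
apply: (@le_trans _ _ (\sum_(k <oo) P (bad_scale (k0 + k)))%E).
  apply: measure_sigma_subadditive.
  - by move=> k; exact: measurable_bad_scale.
  - exact: measurable_modulus_event.
  - exact: modulus_event_bad.
apply: nneseries_le => // j.
apply: (@le_trans _ _ (\sum_(k < j) (tail_cst * E * 2^-1 ^+ k)%:E)%E).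
  apply: lee_sum => k _; apply: (le_trans (bad_scale_le (k0 + k) t1)).
  rewrite lee_fin mulrAC.
  have h1 : 2 ^+ k0 <= 2 ^+ (k0 + k) :> R by rewrite ler_weXn2l ?ler1n// leq_addr.
  have h2 : expR (- (decay * t * 2 ^+ (k0 + k) / 2)) <= E.
    rewrite ler_expR lerN2 ler_wpM2r// ler_wpM2l// mulr_ge0 ?ltW//.
  have h3 : 2^-1 ^+ (k0 + k) <= 2^-1 ^+ k :> R.
    by rewrite ler_wiXn2l ?invf_le1 ?ler1n// leq_addl.
  apply: ler_pM => //; first by rewrite mulr_ge0 ?expR_ge0// ltW.
  by rewrite ler_wpM2l// ltW.
rewrite sumEFin lee_fin -mulr_sumr [leRHS](_ : _ = tail_cst * E * 2); last by ring.
have tE : 0 <= tail_cst * E by apply: mulr_ge0; [exact: ltW|exact: expR_ge0].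
rewrite ler_wpM2l//.
suff h : \sum_(i < j) 2^-1 ^+ i <= 2 * (1 - 2^-1 ^+ j) :> R.
  have q0 : 0 < 2^-1 ^+ j :> R by rewrite exprn_gt0.
  lra.
elim: j => [|j ih]; first by rewrite big_ord0 expr0 subrr mulr0.
by rewrite big_ord_recr/= exprS; lra.
Qed.

Lemma log_rate_le k0 delta : 1 <= t -> `|ln (2 * tail_cst)| <= t -> 0 < delta ->
  delta <= b / 4 * scale4 k0 ^+ 2 ->
  (log_rate P t (modulus_event W t delta b) <= (1 - decay * 2 ^+ k0 / 2)%:E)%E.
Proof.
move=> t1 tl d0 hd; rewrite /log_rate; case: ifP => [_|/negbT Pn0]; first exact: leNye.
have Pf : P (modulus_event W t delta b) \is a fin_num.
  by apply: fin_num_measure; exact: measurable_modulus_event.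
have := modulus_event_prob t1 d0 hd; move: Pn0; rewrite -(fineK Pf).
set p := fine _; rewrite eqe lee_fin => pn0 pE.
have pp : 0 < p by rewrite lt_neqAle eq_sym pn0 fine_ge0.
have cp : 0 < 2 * tail_cst by rewrite mulr_gt0 ?tail_cst_gt0.
rewrite lee_fin mulrC ler_pdivrMr//.
apply: (@le_trans _ _ (ln (2 * tail_cst * expR (- (decay * t * 2 ^+ k0 / 2))))).
  by rewrite ler_ln ?posrE// mulr_gt0 ?expR_gt0.
rewrite lnM ?posrE ?expR_gt0// expRK.
have := le_trans (ler_norm _) tl; set l := ln _.
by rewrite mulrBl mul1r [decay * t * _]mulrAC -!mulrA [t / 2]mulrC !mulrA; lra.
Qed.

End brownian_potential.

Section path_extension.
Context {R : realType} {d : measure_display} {T : measurableType d}.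
Variables (P : probability T R) (W : R -> T -> 'rV[R]_3).
Hypothesis BM : is_BM3 P W.

(* [W] is unconstrained at negative times, so it is first frozen there. *)
Definition frozen_path (s : R) (w : T) := W (Num.max s 0) w.

Lemma frozen_path_id s : 0 <= s -> frozen_path s = W s.
Proof. by move=> s0; rewrite /frozen_path max_l. Qed.

Lemma continuous_frozen_path w k : continuous (fun s => frozen_path s w ord0 k).
Proof.
have [_ /(_ w)/subspace_continuousP cW _ _] := BM; move=> s.
have cmax : Num.max x 0 @[x --> s] --> within [set t : R | 0 <= t] (nbhs (Num.max s 0)).
  move=> B /=; rewrite /within/= => hB.
  have cm : {for s, continuous (fun x : R => Num.max x 0)}.
    by apply: continuous_max => //; exact: cvg_cst.
  have := cm _ hB; rewrite !nbhs_simpl/=; apply: filterS => x; apply.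
  by rewrite /= le_max lexx orbT.
have s0 : 0 <= Num.max s 0 by rewrite le_max lexx orbT.
have c1 := cvg_comp _ _ cmax (cW _ s0).
exact: (cvg_comp _ _ c1 (@coord_continuous R 1 3 ord0 k (W (Num.max s 0) w))).
Qed.

Lemma measurable_frozen_path k :
  measurable_fun setT (fun p : R * T => frozen_path p.1 p.2 ord0 k).
Proof.
have [_ _ mW _] := BM.
apply: (@measurable_continuous_paths R d T (fun s w => frozen_path s w ord0 k)) => [w|s].
  exact: continuous_frozen_path.
exact: mW.
Qed.

Lemma fdd_frozen_path (n : nat) (tt : nat -> R) (A : nat -> 'I_3 -> set R) :
  tt 0%N = 0 ->
  (forall i, (i < n)%N -> tt i < tt i.+1) ->
  (forall i k, measurable (A i k)) ->
  P [set w | forall i (k : 'I_3), (i < n)%N ->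
       A i k ((frozen_path (tt i.+1) w - frozen_path (tt i) w) ord0 k)] =
  (\prod_(i < n) \prod_(k < 3)
      normal_prob 0 (Num.sqrt (tt i.+1 - tt i)) (A i k))%E.
Proof.
move=> tt0 ttS mA; have [_ _ _ <-//] := BM.
have ge0 i : (i <= n)%N -> 0 <= tt i.
  elim: i => [|i ih] i_n; first by rewrite tt0.
  by rewrite (le_trans (ih (ltnW i_n)))// ltW// ttS.
congr (P _); apply/seteqP; split => w /= h i k i_n; have := h i k i_n;
  by rewrite !frozen_path_id ?ge0// ltnW.
Qed.

Lemma modulus_event_frozen t delta b :
  modulus_event frozen_path t delta b = modulus_event W t delta b.
Proof.
have LE : Lambda frozen_path t = Lambda W t.
  apply/funext => w; apply/funext => x.
  apply: (congr1 (fun z => (t^-1)%:E * z)%E).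
  by apply: eq_integral => s; rewrite inE/= => /andP[s0 _]; rewrite frozen_path_id.
by rewrite /modulus_event LE.
Qed.

End path_extension.

Unset Implicit Arguments.

Theorem theorem1p3 (R : realType) (d : measure_display) (T : measurableType d)
  (P : probability T R) (W : R -> T -> 'rV[R]_3) :
  is_BM3 P W ->
  forall b : R, 0 < b ->
  (fun delta : R =>
     limf_esup (fun t : R => log_rate P t (modulus_event W t delta b))
               (pinfty_nbhs R))
    @ 0^'+ --> -oo%E.
Proof.
move=> BM b b0.
have mW := measurable_frozen_path BM; have fddW := fdd_frozen_path BM.
have kp := decay_gt0 b0.
apply/cvgeNyPle => A.
have [k0 hk0] : exists k0 : nat, 1 - decay b * 2 ^+ k0 / 2 <= A.
  have /scale4_lt[k hk] : 0 < (decay b) / (2 * (`|1 - A| + 1)).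
    by rewrite divr_gt0// mulr_gt0// ltr_wpDl.
  exists (2 * k)%N; have -> : 2 ^+ (2 * k) = (scale4 k)^-1 :> R.
    by rewrite scale4V exprM; congr (_ ^+ _); rewrite -natrX.
  have sp := @scale4_gt0 R k.
  have hA := ler_norm (1 - A).
  suff : 2 * (1 - A) <= decay b / scale4 k by lra.
  rewrite ler_pdivlMr//; move: hk; rewrite ltr_pdivlMr; last first.
    by rewrite mulr_gt0// ltr_wpDl.
  have : scale4 k * (1 - A) <= scale4 k * `|1 - A| by rewrite ler_wpM2l// ltW.
  by set a := `|_|; nra.
have e0 : 0 < b / 4 * scale4 k0 ^+ 2.
  by rewrite mulr_gt0 ?divr_gt0// exprn_gt0// scale4_gt0.
have h1 : \forall delta \near (0:R)^'+, delta < b / 4 * scale4 k0 ^+ 2.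
  exact: nbhs_right_lt.
have h2 : \forall delta \near (0:R)^'+, 0 < delta by exact: nbhs_right_gt.
apply: filterS2 h1 h2 => delta dlt d0.
pose t1 := Num.max 1 `|ln (2 * tail_cst b)|.
apply: (@le_trans _ _ (ereal_sup
   [set log_rate P t (modulus_event W t delta b) | t in [set t | t1 < t]])).
  apply: ereal_inf_lbound; exists [set t | t1 < t] => //.
  by exists t1; split => //; exact: num_real.
apply: ge_ereal_sup => _ [t /= t1t <-].
have /andP[t_ge1 tl] : (1 <= t) && (`|ln (2 * tail_cst b)| <= t).
  by move: (ltW t1t); rewrite ge_max.
have t0 : 0 < t by rewrite (lt_le_trans ltr01).
rewrite -modulus_event_frozen.
apply: (le_trans (log_rate_le mW fddW t0 b0 t_ge1 tl d0 (ltW dlt))).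
by rewrite lee_fin.
Qed.
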